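(* Let $\mathcal{I}$ be one of the following ideals: $\mathrm{FIN}$, $\mathrm{FIN}\times 0$, $\mathcal{I}_s$, $\mathcal{I}_s\times 0$, or a $\mathbf{\Pi}^1_1$ ideal of the form $\mathcal{J}\times\mathrm{FIN}$ or $\mathcal{J}\times\mathcal{I}_s\times 0$ or $\mathcal{J}\times\mathrm{FIN}\times 0$ (where $\mathcal{J}$ is an ideal on a countable set). Then for any $\mathbf{\Sigma}^1_1$ equivalence relation $F$ of countable index over $E_{\mathcal{I}}$ we have $E_{\mathcal{I}} \sqsubseteq_c F$.
   Context: For an ideal $\mathcal{I}$ on a countable set $P$, $E_{\mathcal{I}}$ is the equivalence relation on $2^P$ given by $x \mathrel{E_{\mathcal{I}}} y$ iff $\{p : x(p)\neq y(p)\}\in\mathcal{I}$. Ideals on $\omega$: $0=\{\emptyset\}$; $\mathrm{FIN}$ is the ideal of finite subsets of $\omega$; $\mathcal{I}_s=\{A\subseteq\omega : \sum_{n\in A}\frac{1}{n+1}<\infty\}$. For ideals $\mathcal{I}$ on $P$ and $\mathcal{J}$ on $Q$, the ideal $\mathcal{I}\times\mathcal{J}$ on $P\times Q$ is defined by $A\in\mathcal{I}\times\mathcal{J}$ iff $\{x\in P : A_x\notin\mathcal{J}\}\in\mathcal{I}$, where $A_x=\{q : (x,q)\in A\}$. An ideal on $P$ is $\mathbf{\Pi}^1_1$ if it is so as a subset of $2^P$ (identifying sets with characteristic functions). $F$ is of countable index over $E$ if $E\subseteq F$ (on the same space) and each $F$-class contains only countably many $E$-classes. $E\sqsubseteq_c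 F$ means there is a continuous injective map $\varphi$ from the space of $E$ to the space of $F$ with $x \mathrel{E} y \Leftrightarrow \varphi(x) \mathrel{F} \varphi(y)$. *)

(* Defs.v *)
From Stdlib Require Export RelationClasses.
From mathcomp Require Export all_boot all_algebra all_classical all_reals.
From mathcomp Require Export ereal topology function_spaces esum.

Set Implicit Arguments.
Unset Strict Implicit.
Unset Printing Implicit Defensive.

Import GRing.Theory.
Local Open Scope classical_set_scope.
Local Open Scope ring_scope.

Definition is_ideal (P : Type) (I : set (set P)) : Prop :=
  [/\ I set0,
      forall A B : set P, A `<=` B -> I B -> I A &
      forall A B : set P, I A -> I B -> I (A `|` B)].

Definition ideal0 : set (set nat) := [set set0].

Definition FIN : set (set nat) := [set A | finite_set A].

Definition summable_ideal (R : realType) : set (set nat) :=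
  [set A | (\esum_(n in A) ((n.+1%:R)^-1 : R)%:E < +oo)%E].

Definition ideal_prod (P Q : Type) (I : set (set P)) (J : set (set Q)) :
    set (set (P * Q)) :=
  [set A | I [set x | ~ J [set q | A (x, q)]]].

(* The Cantor space 2^P is {ptws P -> bool} (product of discrete spaces). *)
Definition E_ideal (P : Type) (I : set (set P)) (x y : {ptws P -> bool}) :
    Prop :=
  I [set p | x p != y p].

(* Boldface Sigma^1_1 and Pi^1_1, intended for Polish X: projections of closed
   subsets of X * Baire space, and their complements. *)
Definition Sigma11 (X : topologicalType) (A : set X) : Prop :=
  exists C : set (X * {ptws nat -> nat}), closed C /\ A = fst @` C.

Definition Pi11 (X : topologicalType) (A : set X) : Prop := Sigma11 (~` A).

Definition Pi11_ideal (P : Type) (I : set (set P)) : Prop :=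
  Pi11 [set x : {ptws P -> bool} | I [set p | x p]].

Definition Sigma11_rel (X : topologicalType) (F : X -> X -> Prop) : Prop :=
  Sigma11 [set xy : X * X | F xy.1 xy.2].

(* E y, as a set, is the E-class of y. *)
Definition countable_index_over (X : Type) (F E : X -> X -> Prop) : Prop :=
  (forall x y, E x y -> F x y) /\
  (forall x, countable [set (E y : set X) | y in [set y | F x y]]).

Definition continuously_embeds (X Y : topologicalType)
    (E : X -> X -> Prop) (F : Y -> Y -> Prop) : Prop :=
  exists phi : X -> Y,
    [/\ continuous phi, injective phi &
        forall x y, E x y <-> F (phi x) (phi y)].

(* Triple products are associated to the left; re-association is a bijection of
   the underlying sets that identifies the two bracketings. *)
Inductive listed_ideal (R : realType) : forall P : countType,
    set (set P) -> Prop :=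
| listed_FIN : @listed_ideal R nat FIN
| listed_FIN0 : @listed_ideal R (nat * nat)%type (ideal_prod FIN ideal0)
| listed_sum : @listed_ideal R nat (summable_ideal R)
| listed_sum0 :
    @listed_ideal R (nat * nat)%type (ideal_prod (summable_ideal R) ideal0)
| listed_JFIN (P : countType) (J : set (set P)) :
    is_ideal J -> Pi11_ideal (ideal_prod J FIN) ->
    @listed_ideal R (P * nat)%type (ideal_prod J FIN)
| listed_Jsum0 (P : countType) (J : set (set P)) :
    is_ideal J ->
    Pi11_ideal (ideal_prod (ideal_prod J (summable_ideal R)) ideal0) ->
    @listed_ideal R (P * nat * nat)%type
      (ideal_prod (ideal_prod J (summable_ideal R)) ideal0)
| listed_JFIN0 (P : countType) (J : set (set P)) :
    is_ideal J ->
    Pi11_ideal (ideal_prod (ideal_prod J FIN) ideal0) ->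
    @listed_ideal R (P * nat * nat)%type
      (ideal_prod (ideal_prod J FIN) ideal0).

(* Main.v *)
Require Import Defs.
From mathcomp Require Import all_order zify lra.
Set Implicit Arguments.
Unset Strict Implicit.
Unset Printing Implicit Defensive.
Import Order.TTheory GRing.Theory Num.Theory.
Local Open Scope classical_set_scope.
Local Open Scope ring_scope.

(** Positions are grouped into fibres and carry weights; two points are
    separated on a fibre p when the positions of p where they differ have
    infinite total weight.  The embedding psi is x |-> c + (the sum of the
    blocks e_j with x_j = 1), where e_j is a finite set of positions in the
    fibre of j of weight comparable to that of j; hence psi respects E_I, and
    the point is to prevent F (psi x) (psi y) when x and y are inequivalent.

    Both F and the family of J-positive sets A are analytic, so the tuples
    (a, b, A) with F a b and A positive, together with witnesses, form a closed
    set Y.  Call a part of Y small if, for comeagerly many a, countably many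
    continuous functions h_i of a capture it: there are i and p in A such that b
    is not separated from h_i(a) on p.  If Y were not small, amalgamating nowhere
    small pieces of Y over a common generic a would yield a perfect family of
    points F-related to a which are pairwise separated on every fibre of their
    sets A, against countable index.  So Y is small, and it remains to choose c
    and the e_j generically enough that psi x lies in the comeager set and
    psi y is separated from h_i(psi x) on p as soon as the j in p with x_j = 0
    and y_j = 1 have infinite weight.  The asymmetry is harmless since F is
    symmetric and J is an ideal.

    An ideal J x 0 is reduced to J x FIN by repeating every bit infinitely
    often, which turns disagreement into infinite disagreement. *)

(** * Cylinders and weights *)

Section Cylinders.
Context {T : eqType}.
Implicit Types (x y : nat -> T) (s t : seq T).

Definition cyl s x : bool := mkseq x (size s) == s.

Lemma take_mkseq x m n : (m <= n)%N -> take m (mkseq x n) = mkseq x m.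
Proof. by move=> /minn_idPl mn; rewrite /mkseq -map_take take_iota mn. Qed.

Lemma cyl_mkseq x n : cyl (mkseq x n) x.
Proof. by rewrite /cyl size_mkseq. Qed.

Lemma cylP s x d :
  reflect (forall i, (i < size s)%N -> nth d s i = x i) (cyl s x).
Proof.
apply: (iffP eqP) => [sx i il|h]; first by rewrite -sx nth_mkseq.
apply: (@eq_from_nth _ d); rewrite size_mkseq // => i il.
by rewrite nth_mkseq // h.
Qed.

Lemma mkseq_prefix x m n : (m <= n)%N -> prefix (mkseq x m) (mkseq x n).
Proof. by move=> mn; rewrite prefixE size_mkseq take_mkseq// eqxx. Qed.

Lemma cyl_prefix s t x : prefix s t -> cyl t x -> cyl s x.
Proof.
move=> /prefixP[r ->]; rewrite /cyl size_cat => /eqP h.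
by have /eqP := congr1 (take (size s)) h; rewrite take_size_cat// take_mkseq//
  leq_addr.
Qed.

Lemma prefix_cyl s x n : cyl s x -> (size s <= n)%N -> prefix s (mkseq x n).
Proof. by move=> sx sn; rewrite prefixE take_mkseq. Qed.

Lemma cyl_size_prefix s t x :
  cyl s x -> cyl t x -> (size s <= size t)%N -> prefix s t.
Proof. by move=> sx tx st; rewrite -(eqP tx); exact: prefix_cyl. Qed.

Lemma prefix_nth d s t i : prefix s t -> (i < size s)%N -> nth d t i = nth d s i.
Proof. by move=> /prefixP[r ->] si; rewrite nth_cat si. Qed.

Lemma nat_limit (f : nat -> seq T) (d : T) :
  (forall n, prefix (f n) (f n.+1)) -> (forall n, exists m, (n <= size (f m))%N) ->
  exists x, forall n, cyl (f n) x.
Proof.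
move=> fS fsz.
have fle m n : (m <= n)%N -> prefix (f m) (f n).
  move=> /subnK <-; elim: (n - m)%N => [|k ih]; first exact: prefix_refl.
  by rewrite addSn; exact: prefix_trans (fS _).
have [g gP] := choice fsz.
exists (fun i => nth d (f (g i.+1)) i) => n; apply/(cylP _ _ d) => i si.
have [ng|gn] := leqP n (g i.+1); first by rewrite (prefix_nth _ (fle _ _ ng)).
by rewrite (prefix_nth _ (fle _ _ (ltnW gn)))// (leq_trans _ (gP _)).
Qed.

End Cylinders.

Section WeightedDifferences.
Context {R : realFieldType} {P : countType} (pos : nat -> option P).
Context (w : nat -> R) (w_ge0 : forall q, 0 <= w q).

(** Numbers [q] with [pos q = None] code no position and lie in no fibre. *)
Definition wsum p N (D : nat -> bool) : R :=
  \sum_(0 <= q < N | (pos q == Some p) && D q) w q.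

Lemma wsum_ge0 p N D : 0 <= wsum p N D.
Proof. exact: sumr_ge0. Qed.

Lemma wsum_le p M N (D E : nat -> bool) :
  (M <= N)%N -> (forall q, (q < M)%N -> D q -> E q) -> wsum p M D <= wsum p N E.
Proof.
move=> MN DE; rewrite /wsum [leRHS](big_cat_nat _ MN)//= -[leLHS]addr0 lerD
  ?sumr_ge0//.
rewrite big_mkcond [leRHS]big_mkcond /=; apply: ler_sum_nat => q /andP[_ qM].
case: eqP => //= _; case: ifPn => [/DE ->//|_]; by case: ifP.
Qed.

Definition separated p (x y : nat -> bool) :=
  forall m : nat, exists N, m%:R <= wsum p N (fun q => x q != y q).

Definition seqdiff p (s t : seq bool) : R :=
  wsum p (minn (size s) (size t)) (fun q => nth false s q != nth false t q).

(** Weights are nonnegative and extensions keep old disagreements, so separation gained during the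
    fusion is never lost. *)
Lemma seqdiff_le p s s' t t' : prefix s s' -> prefix t t' ->
  seqdiff p s t <= seqdiff p s' t'.
Proof.
move=> ss tt; have := size_prefix ss; have := size_prefix tt => h1 h2.
apply: wsum_le; first by rewrite leq_min !geq_min h1 h2 ?orbT.
move=> q; rewrite ltn_min => /andP[qs qt].
by rewrite (prefix_nth _ ss)// (prefix_nth _ tt).
Qed.

Lemma seqdiff_cyl p s t x y : cyl s x -> cyl t y ->
  seqdiff p s t = wsum p (minn (size s) (size t)) (fun q => x q != y q).
Proof.
move=> /(cylP _ _ false) sx /(cylP _ _ false) ty; apply: le_anti; apply/andP.
by split; apply: wsum_le => // q; rewrite ltn_min => /andP[qs qt]; rewrite sx ?ty.
Qed.

End WeightedDifferences.

(** * Uniformization *)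

(** The dense open subset of Cantor space encoded by [D] is the union of the cylinders of its
    members, that is [meets D]. *)
Definition dense_open (D : seq bool -> Prop) :=
  forall u, exists2 v, prefix u v & D v.

Definition meets (D : seq bool -> Prop) (a : nat -> bool) :=
  exists2 u, cyl u a & D u.

(* A guess is a tree-like family of pairs (V, t), each promising the initial
   segment t of some point h(a) to all a in V; it stands for a continuous
   function h defined on a comeager subset of U. *)
Record guess (P : Type) := Guess {
  guess_pos : P;
  guess_bound : nat;
  guess_dom : seq bool;
  guess_val : seq bool -> seq bool -> Prop }.

Definition good_guess (P : Type) (g : guess P) :=
  (exists t, guess_val g (guess_dom g) t) /\
  forall V t, guess_val g V t -> forall V' n, prefix V V' ->
    exists V'' t', [/\ prefix V' V'', prefix t t', (n <= size t')%N &
                       guess_val g V'' t'].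

Section Uniformization.
Context {R : realFieldType} {P : countType} (pos : nat -> option P).
Context (w : nat -> R) (w_ge0 : forall q, 0 <= w q).
Local Notation wsum := (wsum pos w).
Local Notation seqdiff := (seqdiff pos w).
Local Notation separated := (separated pos w).

(** Every promise valid for [a] is bounded, not only those along one branch, so the construction of
    [psi] may later follow whichever extensions suit it. *)
Definition captured (g : guess P) (a b : nat -> bool) :=
  cyl (guess_dom g) a /\
  forall V t, guess_val g V t -> cyl V a ->
    wsum (guess_pos g) (size t) (fun q => b q != nth false t q) < (guess_bound
      g)%:R.

Context {K : countType} (Y : (nat -> bool) -> (nat -> K) -> Prop).
Context (bitB bitA : K -> bool).
Hypothesis Y_closed : forall a y,
  (forall n, exists a' y', [/\ Y a' y', cyl (mkseq a n) a' & cyl (mkseq y n) y']) ->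
  Y a y.

Definition covered (g : nat -> option (guess P)) (a : nat -> bool) (y : nat -> K) :=
  exists i ga, [/\ g i = Some ga, bitA (y (pickle (guess_pos ga))) &
                   captured ga a (bitB \o y)].

(* The sigma-ideal of sets covered, over comeagerly many a, by countably many
   guesses. *)
Definition small (Z : (nat -> bool) -> (nat -> K) -> Prop) :=
  exists (D : nat -> seq bool -> Prop) (g : nat -> option (guess P)),
    [/\ forall i, dense_open (D i), forall i ga, g i = Some ga -> good_guess ga &
        forall a y, Z a y -> (forall i, meets (D i) a) -> covered g a y].

Lemma small_sub (Z Z' : (nat -> bool) -> (nat -> K) -> Prop) :
  (forall a y, Z a y -> Z' a y) -> small Z' -> small Z.
Proof. by move=> ZZ [D [g [h1 h2 h3]]]; exists D, g; split=> // a y /ZZ;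
  exact: h3. Qed.

Lemma dense_openT : dense_open (fun=> True).
Proof. by move=> u; exists u => //; exact: prefix_refl. Qed.

Lemma small0 : small (fun _ _ => False).
Proof.
by exists (fun _ _ => True), (fun=> None); split=> // _; exact: dense_openT.
Qed.

Lemma small_bigcup (Z : nat -> (nat -> bool) -> (nat -> K) -> Prop) :
  (forall i, small (Z i)) -> small (fun a y => exists i, Z i a y).
Proof.
move=> sZ.
have /choice[Dg DgP] : forall i,
    exists Dg : (nat -> seq bool -> Prop) * (nat -> option (guess P)),
   [/\ forall i, dense_open (Dg.1 i),
       forall i ga, Dg.2 i = Some ga -> good_guess ga &
       forall a y, Z i a y -> (forall i, meets (Dg.1 i) a) -> covered Dg.2 a y].
  by move=> i; have [D [g h]] := sZ i; exists (D, g).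
exists (fun k => if unpickle k is Some (i, j) then (Dg i).1 j else fun=> True).
exists (fun k => if unpickle k is Some (i, j) then (Dg i).2 j else None); split.
- move=> k; case: (unpickle k) => [[i j]|]; last exact: dense_openT.
  by have [] := DgP i.
- by move=> k ga; case: (unpickle k) => [[i j]|//]; have [_ + _] := DgP i; exact.
- move=> a y [i Zi] ma; have [_ _ /(_ a y Zi)] := DgP i; case.
    by move=> j; have := ma (pickle (i, j)); rewrite pickleK.
  by move=> j [ga [h1 h2 h3]]; exists (pickle (i, j)), ga; rewrite pickleK.
Qed.

Lemma small_bigcup_count (I : countType)
    (Z : I -> (nat -> bool) -> (nat -> K) -> Prop) :
  (forall i, small (Z i)) -> small (fun a y => exists i, Z i a y).
Proof.
move=> sZ.
have h := @small_bigcup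
  (fun n => if unpickle n is Some i then Z i else fun _ _ => False).
apply: small_sub (h _).
  by move=> a y [i Zi]; exists (pickle i); rewrite pickleK.
by move=> n; case: (unpickle n) => [i|]; [exact: sZ|exact: small0].
Qed.

Lemma smallU (Z Z' : (nat -> bool) -> (nat -> K) -> Prop) :
  small Z -> small Z' -> small (fun a y => Z a y \/ Z' a y).
Proof.
move=> sZ sZ'.
apply: small_sub (small_bigcup_count (Z := fun b : bool => if b then Z else Z') _).
  by move=> a y [h|h]; [exists true|exists false].
by case.
Qed.

Lemma small_nowhere_dense D : dense_open D -> small (fun a _ => ~ meets D a).
Proof.
by move=> dD; exists (fun=> D), (fun=> None); split=> // a y nm /(_ 0%N).
Qed.

Lemma small_captured g : good_guess g ->
  small (fun a y => bitA (y (pickle (guess_pos g))) /\ captured g a (bitB \o y)).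
Proof.
move=> gg; exists (fun _ _ => True), (fun=> Some g); split.
- by move=> _; exact: dense_openT.
- by move=> _ ga [<-].
- by move=> a y [h1 h2] _; exists 0%N, g.
Qed.

(** * Nowhere small pieces of [Y] and their refinement *)

Definition over u s (a : nat -> bool) (y : nat -> K) :=
  [/\ Y a y, cyl u a & cyl s y].

Definition large u s := forall u', prefix u u' -> ~ small (over u' s).

Lemma large_prefix u u' s s' : prefix u u' -> prefix s s' -> large u s' ->
  large u' s.
Proof.
move=> uu ss l u'' u'u'' sm; apply: (l u''); first exact: prefix_trans u'u''.
by apply: small_sub sm => a y [? ? ?]; split=> //; exact: cyl_prefix ss _.
Qed.

Lemma large_inhabited u s : large u s -> exists a y, over u s a y.
Proof.
move=> /(_ u (prefix_refl _)) ns; apply: contrapT => h; apply: ns.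
by apply: small_sub small0 => a y o; apply: h; exists a, y.
Qed.

(** A Banach category argument: otherwise the sequences over which the piece is small would be dense
    below [u]. Off the union of their cylinders everything is small, and inside it countably many
    small pieces suffice. *)
Lemma not_small_large u s : ~ small (over u s) ->
  exists2 u', prefix u u' & large u' s.
Proof.
move=> ns; apply: contrapT => h; apply: ns.
have hs u' : prefix u u' -> exists2 u'', prefix u' u'' & small (over u'' s).
  move=> uu'; apply: contrapT => h'; apply: h; exists u' => // u'' u'u'' sm.
  by apply: h'; exists u''.
pose D v := small (over v s) \/ ~~ prefix u v && ~~ prefix v u.
have dD : dense_open D.
  move=> v; have [uv|nuv] := boolP (prefix u v).
    by have [v' ? ?] := hs v uv; exists v' => //; left.
  have [vu|nvu] := boolP (prefix v u).
    have [v' uv' ?] := hs u (prefix_refl _); exists v'; last by left.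
    exact: prefix_trans uv'.
  by exists v; [exact: prefix_refl|right; rewrite nuv].
pose Z v := if `[< small (over v s) >] then over v s else fun _ _ => False.
have sZ v : small (Z v).
  by rewrite /Z; case: asboolP => // _; exact: small0.
apply: small_sub (smallU (small_nowhere_dense dD) (small_bigcup_count sZ)) =>
  a y [Ya ua sy].
have [[v va [Dv|/andP[nuv nvu]]]|?] := pselect (meets D a); last by left.
  by right; exists v; rewrite /Z; case: asboolP.
by have [/(cyl_size_prefix ua va)|/ltnW/(cyl_size_prefix va ua)] :=
  leqP (size u) (size v);
  rewrite ?(negbTE nuv) ?(negbTE nvu).
Qed.

(** As [K] is countable, the possible next entries split the piece into countably many; were all of
    them small, so would the piece be. *)
Lemma large_extend1 u s : large u s ->
  exists u' k, prefix u u' /\ large u' (rcons s k).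
Proof.
move=> l; apply: contrapT => h; apply: (l u (prefix_refl _)).
apply: small_sub (small_bigcup_count (Z := fun k => over u (rcons s k)) _).
  move=> a y [Ya ua sy]; exists (y (size s)); split => //.
  by rewrite /cyl size_rcons mkseqS (eqP sy).
move=> k; apply: contrapT => /not_small_large[u' uu' l']; apply: h.
by exists u', k.
Qed.

Lemma large_extend n u s : large u s ->
  exists u' s', [/\ prefix u u', prefix s s', (n <= size s')%N & large u' s'].
Proof.
move=> l; elim: n => [|n [u' [s' [h1 h2 h3 h4]]]].
  by exists u, s; split => //; exact: prefix_refl.
have [u'' [k [h5 h6]]] := large_extend1 h4.
exists u'', (rcons s' k); split => //.
- exact: prefix_trans h5.
- exact: prefix_trans (prefix_rcons _ _).
- by rewrite size_rcons.
Qed.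

(* The node s already decides that p belongs to A. *)
Definition active (s : seq K) (p : P) := nth false (map bitA s) (pickle p).

Lemma active_prefix s s' p : prefix s s' -> active s p -> active s' p.
Proof.
rewrite /active => /prefixP[r ->]; rewrite map_cat nth_cat.
by case: ltnP => // h; rewrite nth_default.
Qed.

Lemma active_cyl s y p : cyl s y -> active s p -> bitA (y (pickle p)).
Proof.
rewrite /active => /eqP <-; case: (ltnP (pickle p) (size s)) => h.
  by rewrite -map_comp nth_mkseq.
by rewrite nth_default// size_map size_mkseq.
Qed.

Lemma cyl_active s y p : cyl s y -> (pickle p < size s)%N -> bitA (y (pickle p)) ->
  active s p.
Proof. by rewrite /active => /eqP <-; rewrite size_mkseq => h;
  rewrite -map_comp nth_mkseq. Qed.

Local Notation bits := (map bitB).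

Lemma prefix_bits s s' : prefix s s' -> prefix (bits s) (bits s').
Proof. by move=> /prefixP[r ->]; rewrite map_cat prefix_prefix. Qed.

Lemma cyl_bits s y : cyl s y -> cyl (bits s) (bitB \o y).
Proof. by move=> /eqP <-; rewrite -map_comp; exact: cyl_mkseq. Qed.

(* Otherwise the initial segments promised by s2 would form a guess capturing
   everything above s1. *)
Lemma large_split u s1 s2 p m : large u s1 -> large u s2 -> active s1 p ->
  exists u' s1' s2', [/\ prefix u u', prefix s1 s1', prefix s2 s2',
    large u' s1' /\ large u' s2' & m%:R <= seqdiff p (bits s1') (bits s2')].
Proof.
move=> l1 l2 act; apply: contrapT => h; apply: (l1 u (prefix_refl _)).
(* Each extension of [s2] that is large above [V] is a promise; [large_extend] lengthens it, which
   makes the guess good. *)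
pose H V t := prefix u V /\ exists s2', [/\ prefix s2 s2', large V s2' & t
  = bits s2'].
pose g := Guess p m u H.
have gg : good_guess g.
  split; first by exists (bits s2); split; [exact: prefix_refl|exists s2;
    split => //; exact: prefix_refl].
  move=> V t [uV [s2' [h1 h2 ->]]] V' n VV'.
  have [V'' [s2'' [h3 h4 h5 h6]]] := large_extend n (large_prefix VV'
    (prefix_refl _) h2).
  exists V'', (bits s2''); split => //; first exact: prefix_bits.
    by rewrite size_map.
  split; first exact: prefix_trans (prefix_trans uV VV') h3.
  by exists s2''; split => //; exact: prefix_trans h4.
(* The points over some small pair form a small set, because there are only countably many pairs. *)
pose Z (vs : seq bool * seq K) :=
  if `[< small (over vs.1 vs.2) >] then over vs.1 vs.2 else fun _ _ => False.
have sZ v : small (Z v).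
  by rewrite /Z; case: asboolP => // _; exact: small0.
apply: small_sub (smallU (small_captured gg) (small_bigcup_count sZ)) =>
  a y [Ya ua s1y].
have [c|nc] := pselect (captured g a (bitB \o y)).
  by left; split => //; exact: active_cyl act.
right; apply: contrapT => nZ; apply: nc; split => // V t [uV [s2' [h1 h2 ->]]] Va.
rewrite ltNge; apply/negP => /= mle.
(* A length of at least [size s2'] lets the comparison with [mkseq y n] reach all of [t]. *)
pose n := maxn (size s1) (size s2').
have s1n : prefix s1 (mkseq y n) by apply: prefix_cyl => //; rewrite leq_maxl.
apply: nZ; exists (V, mkseq y n); rewrite /Z.
case: asboolP => [_|nsm]; first by split => //=; exact: cyl_mkseq.
(* A pair that is not small refines to a large one, which gives the very split excluded by [h]. *)
exfalso; have [V' VV' l'] := not_small_large nsm.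
apply: h; exists V', (mkseq y n), s2'; split => //.
- exact: prefix_trans VV'.
- split => //; exact: large_prefix (prefix_refl _) h2.
- apply: le_trans mle _; rewrite /seqdiff !size_map size_iota; apply: wsum_le => //.
    by rewrite leq_min leqnn leq_maxr.
  move=> q qs; rewrite -map_comp nth_mkseq//= (leq_trans qs)// leq_maxr//.
Qed.

(** The requirements in [T] are met one at a time, and later extensions preserve earlier ones. All
    nodes share the same growing [u], since the points to be built lie over a single [a]. *)
Lemma large_fuse (I : eqType) (T : seq (I * I * P)) m u (f : I -> seq K) :
  (forall i, large u (f i)) ->
  exists u' f', [/\ prefix u u', forall i, prefix (f i) (f' i),
    forall i, large u' (f' i) &
    forall i j p, (i, j, p) \in T -> i != j -> active (f i) p ->
       m%:R <= seqdiff p (bits (f' i)) (bits (f' j))].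
Proof.
elim: T => [|[[i j] p] T ih] lf.
  by exists u, f; split=> // *; exact: prefix_refl.
have [u1 [f1 [h1 h2 h3 h4]]] := ih lf.
have [/andP[ij act]|nact] := boolP ((i != j) && active (f i) p); last first.
  exists u1, f1; split => // i' j' p'; rewrite in_cons => /orP[/eqP[-> ->
    ->] ij act|]; last exact: h4.
  by move: nact; rewrite ij act.
have [u2 [si [sj [h5 h6 h7 [h8 h9] h10]]]] :=
  large_split m (h3 i) (h3 j) (active_prefix (h2 i) act).
pose f2 k := if k == i then si else if k == j then sj else f1 k.
have f12 k : prefix (f1 k) (f2 k).
  rewrite /f2; case: eqP => [->//|_]; case: eqP => [->//|_]; exact: prefix_refl.
exists u2, f2; split.
- exact: prefix_trans h5.
- by move=> k; exact: prefix_trans (f12 k).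
- move=> k; rewrite /f2; case: eqP => // _; case: eqP => // _.
  exact: large_prefix (prefix_refl _) (h3 k).
- move=> i' j' p'; rewrite in_cons => /orP[/eqP[-> -> ->] _ _|h ij' act'].
    by rewrite /f2 eqxx eqxx eq_sym (negbTE ij).
  by apply: le_trans (h4 _ _ _ h ij' act') _; apply: seqdiff_le => //;
    exact: prefix_bits.
Qed.

Lemma large_extend_seq (I : eqType) (s : seq I) n u (f : I -> seq K) :
  (forall i, large u (f i)) ->
  exists u' f', [/\ prefix u u', forall i, prefix (f i) (f' i),
    forall i, large u' (f' i) & forall i, i \in s -> (n <= size (f' i))%N].
Proof.
elim: s => [|i s ih] lf.
  by exists u, f; split=> // *; exact: prefix_refl.
have [u1 [f1 [h1 h2 h3 h4]]] := ih lf.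
have [u2 [si [h5 h6 h7 h8]]] := large_extend n (h3 i).
pose f2 k := if k == i then si else f1 k.
have f12 k : prefix (f1 k) (f2 k).
  rewrite /f2; case: eqP => [->//|_]; exact: prefix_refl.
exists u2, f2; split.
- exact: prefix_trans h5.
- by move=> k; exact: prefix_trans (f12 k).
- move=> k; rewrite /f2; case: eqP => // _.
  exact: large_prefix (prefix_refl _) (h3 k).
- move=> k; rewrite in_cons => /orP[/eqP ->|/h4 h]; first by rewrite /f2 eqxx.
  exact: leq_trans (size_prefix (f12 k)).
Qed.

Definition bitseqs n : seq (seq bool) := map val (enum {: n.-tuple bool}).

Lemma mem_bitseqs n s : (s \in bitseqs n) = (size s == n).
Proof.
apply/mapP/eqP => [[t _ ->]|sn]; first by rewrite size_tuple.
by exists (Tuple (introT eqP sn)); rewrite ?mem_enum.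
Qed.

(** One level of a Cantor scheme. Separation is demanded only on active fibres coded below [n];
    every fibre is reached at some level. *)
Lemma fusion_step n u (f : seq bool -> seq K) : (forall s, large u (f s)) ->
  exists u' f', [/\ prefix u u' /\ (n <= size u')%N,
    forall s, prefix (f (take n s)) (f' s),
    forall s, large u' (f' s),
    forall s, size s = n.+1 -> (n <= size (f' s))%N &
    forall s t p, size s = n.+1 -> size t = n.+1 -> s != t -> (pickle p < n)%N ->
      active (f' s) p -> n%:R <= seqdiff p (bits (f' s)) (bits (f' t))].
Proof.
(* Padding by [n] zeros forces length at least [n] on [u']. *)
move=> lf; pose u0 := u ++ nseq n false.
have uu0 : prefix u u0 by exact: prefix_prefix.
have l0 s : large u0 (f (take n s)) by exact: large_prefix (prefix_refl _) (lf _).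
have [u1 [f1 [h1 h2 h3 h4]]] := large_extend_seq (bitseqs n.+1) n l0.
pose T := [seq (st, p) | st <- [seq (s, t) | s <- bitseqs n.+1, t <- bitseqs n.+1],
    p <- pmap (@unpickle P) (iota 0 n)].
have [u2 [f2 [h5 h6 h7 h8]]] := large_fuse T n h3.
exists u2, f2; split => //.
- split; first exact: prefix_trans (prefix_trans uu0 h1) h5.
  apply: leq_trans (size_prefix h5); apply: leq_trans (size_prefix h1).
  by rewrite size_cat size_nseq leq_addl.
- by move=> s; exact: prefix_trans (h6 s).
- move=> s ss; apply: leq_trans (size_prefix (h6 s)); apply: h4.
  by rewrite mem_bitseqs ss.
- move=> s t p ss tt st pn act; apply: h8 => //.
    apply/allpairsP; exists ((s, t), p); split => //=.
      by apply/allpairsP; exists (s, t); rewrite !mem_bitseqs ss tt.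
    rewrite mem_pmap; apply/mapP; exists (pickle p); last by rewrite pickleK.
    by rewrite mem_iota.
  (* Since [f1 s] already decides [p], activity in [f2 s] goes back to [f1 s], where [large_fuse]
     asks for it. *)
  have ps : (pickle p < size (f1 s))%N.
    by apply: leq_trans pn _; apply: h4; rewrite mem_bitseqs ss.
  move: act; have /prefixP[r ->] := h6 s.
  by rewrite /active map_cat nth_cat size_map ps.
Qed.

(** Iterating [fusion_step] yields one [a] and a point [y r] for each branch [r]. Large pieces are
    inhabited, so members of [Y] come arbitrarily near to [a] and [y r], and [Y_closed] applies. *)
Lemma not_small_perfect : ~ small Y ->
  exists (a : nat -> bool) (y : (nat -> bool) -> nat -> K),
    (forall r, Y a (y r)) /\
    forall r r' p, r <> r' -> bitA (y r (pickle p)) ->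
      separated p (bitB \o y r) (bitB \o y r').
Proof.
move=> nsY.
have [u0 _ l0] : exists2 u', prefix [::] u' & large u' [::].
  by apply: not_small_large => h; apply: nsY; apply: small_sub h => a y ?; split.
pose St := {uf : seq bool * (seq bool -> seq K) | forall s, large uf.1 (uf.2 s)}.
have /choice[next nextP] : forall nx : nat * St, exists x' : St,
   let n := nx.1 in let u := (sval nx.2).1 in let f := (sval nx.2).2 in
   let u' := (sval x').1 in let f' := (sval x').2 in
   [/\ prefix u u' /\ (n <= size u')%N,
    forall s, prefix (f (take n s)) (f' s),
    forall s, size s = n.+1 -> (n <= size (f' s))%N &
    forall s t p, size s = n.+1 -> size t = n.+1 -> s != t -> (pickle p < n)%N ->
      active (f' s) p -> n%:R <= seqdiff p (bits (f' s)) (bits (f' t))].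
  move=> [n [[u f] /= lf]]; have [u' [f' [h1 h2 h3 h4 h5]]] := fusion_step n lf.
  by exists (exist _ (u', f') h3).
pose st := fix st n : St := if n is n'.+1 then next (n', st n')
  else exist (fun uf => forall s, large uf.1 (uf.2 s)) (u0, fun=> [::]) (fun=> l0).
pose U n := (sval (st n)).1; pose f n := (sval (st n)).2.
have lf n s : large (U n) (f n s) by exact: (svalP (st n)).
have stP n := nextP (n, st n).
have [a aP] : exists a, forall n, cyl (U n) a.
  apply: nat_limit => [||n]; first exact: false.
    by move=> n; have [[]] := stP n.
  by exists n.+1; have [[]] := stP n.
(* An element of [K] is wanted only as the default in [nat_limit]. *)
have [k0 _] : exists k : K, True by have [a' [y' _]] := large_inhabited l0;
  exists (y' 0%N).
have /choice[y yP] : forall r : nat -> bool, exists y, forall n,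
  cyl (f n (mkseq r n)) y.
  move=> r; apply: (nat_limit k0) => n; have [_ h2 h3 _] := stP n.
    by have := h2 (mkseq r n.+1); rewrite take_mkseq.
  by exists n.+1; apply: h3; rewrite size_mkseq.
exists a, y; split.
  move=> r; apply: Y_closed => n; have [a' [y' [Y' Ua' fy']]] :=
    large_inhabited (lf n.+1 (mkseq r n.+1)).
  have [[_ h1] _ h2 _] := stP n.
  exists a', y'; split => //.
    by apply: cyl_prefix Ua'; rewrite -(eqP (aP n.+1)) mkseq_prefix.
  by apply: cyl_prefix fy'; rewrite -(eqP (yP r n.+1)) mkseq_prefix// h2//
    size_mkseq.
move=> r r' p rr' act m.
have [i ri] : exists i, r i != r' i.
  by apply: contrapT => h; apply: rr'; apply: funext => i; apply/eqP;
    apply: contrapT => /negP ?; apply: h; exists i.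
(* At this stage the bound is at least [m], the branches have split at [i], and [p] is among the
   fibres treated. *)
pose n := (m + i + (pickle p).+1)%N.
have [_ _ h3 h4] := stP n.
have s1 : size (mkseq r n.+1) = n.+1 by rewrite size_mkseq.
have s2 : size (mkseq r' n.+1) = n.+1 by rewrite size_mkseq.
have n12 : mkseq r n.+1 != mkseq r' n.+1.
  apply: contraNneq ri => /(congr1 (nth false ^~ i)).
  by rewrite /= !nth_mkseq ?/n; [move=> ->|lia|lia].
have pn : (pickle p < n)%N by rewrite /n; lia.
have := h4 _ _ p s1 s2 n12 pn (cyl_active (yP r n.+1) (leq_trans pn (h3 _ s1)) act).
rewrite (seqdiff_cyl _ _ _ (cyl_bits (yP r n.+1)) (cyl_bits (yP r' n.+1)))//.
by move: (minn _ _) => N h; exists N; apply: le_trans h;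
  rewrite ler_nat /n -addnA leq_addr.
Qed.

End Uniformization.

(** * The generic map *)

(** One tail has to serve every base, because outside the blocks all images under [psi] must agree.
    The conditions are met in turn and, being monotone, persist. *)
Lemma common_tail (I : eqType) (s : seq I) (base : I -> seq bool)
    (Q : I -> seq bool -> Prop) :
  (forall i, i \in s -> forall v, prefix (base i) v ->
    exists2 v', prefix v v' & Q i v') ->
  (forall i v v', prefix v v' -> Q i v -> Q i v') ->
  exists w, forall i, i \in s -> Q i (base i ++ w).
Proof.
move=> dQ mQ; elim: s dQ => [|i s ih] dQ; first by exists [::].
have [k ks|w wP] := ih; first by apply: dQ; rewrite in_cons ks orbT.
have [v' /prefixP[r ->] Qv'] := dQ i (mem_head _ _) _ (prefix_prefix _ w).
exists (w ++ r) => k; rewrite in_cons => /orP[/eqP ->|ks]; first by rewrite catA.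
by apply: mQ (wP k ks); rewrite catA prefix_prefix.
Qed.

Section Escape.
Context {R : archiRealFieldType} {P : countType} (pos : nat -> option P).
Context (w : nat -> R) (w_ge0 : forall q, 0 <= w q).
Local Notation wsum := (wsum pos w).
Local Notation captured := (captured pos w).

Lemma wsum_split p M N l (D E : nat -> bool) : (M <= N)%N -> (M <= l)%N ->
  (forall q, (q < M)%N -> D q -> E q) ->
  wsum p M D + wsum p N (fun q => (l <= q)%N && E q) <= wsum p N E.
Proof.
move=> MN Ml DE.
have -> : wsum p N E = wsum p N (fun q => (q < l)%N && E q) + wsum p N (fun q
  => (l <= q)%N && E q).
  rewrite /wsum (bigID (fun q => q < l)%N) /=; congr (_ + _); apply: eq_bigl => q.
    by rewrite -andbA; congr andb; rewrite andbC.
  by rewrite -leqNgt -andbA; congr andb; rewrite andbC.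
rewrite lerD2r; apply: wsum_le => // q qM /(DE _ qM) ->.
by rewrite (leq_trans qM).
Qed.

(** Where one of [d] and [e] holds the other fails, so [f] disagrees with exactly one of them. *)
Lemma wsum_disjoint p N l (d e f : nat -> bool) :
  (forall q, d q -> ~~ e q) -> (forall q, d q || e q -> (l <= q)%N) ->
  wsum p N d + wsum p N e <=
  wsum p N (fun q => (l <= q)%N && (d q != f q)) +
  wsum p N (fun q => (l <= q)%N && (e q != f q)).
Proof.
move=> de le; rewrite /wsum !(big_mkcond (fun q => _ && _)) /= -!big_split /=.
apply: ler_sum => q _; case: (pos q == Some p) => /=; last by lra.
have := w_ge0 q; have := de q; have := le q.
by case: (l <= q)%N; case: (d q); case: (e q); case: (f q) => //= h1 h2 h3;
  rewrite ?addr0 ?add0r; [have := h2 isT|..]; first [lra | have := h1 isT].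
Qed.

(** The upper bound prevents [psi] from creating separation; the lower bound keeps infinite weight
    infinite. *)
Definition small_copies := forall j p l, pos j = Some p ->
  exists l' (e : nat -> bool),
    (forall q, e q -> (l <= q < l')%N /\ pos q = Some p) /\
    w j / 2 <= wsum p l' e <= w j.

Hypothesis copies : small_copies.

Lemma disjoint_copies j p l n : pos j = Some p ->
  exists l' (e : nat -> nat -> bool), [/\ (l <= l')%N,
    forall k q, (k < n)%N -> e k q -> (l <= q < l')%N /\ pos q = Some p,
    forall k, (k < n)%N -> w j / 2 <= wsum p l' (e k) <= w j &
    forall k k' q, (k < n)%N -> (k' < n)%N -> k != k' -> e k q -> ~~ e k' q].
Proof.
move=> pj; elim: n => [|n [l1 [e1 [h1 h2 h3 h4]]]].
  by exists l, (fun _ _ => false).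
have [l2 [e [e2 e3]]] := copies l1 pj.
(* [copies] does not place [l2] beyond [l1]: when [w j] is zero the copy may be empty. *)
pose l3 := maxn l1 l2.
have wsumE l' (d : nat -> bool) : (l' <= l3)%N -> (forall q, d q -> (q < l')%N) ->
    wsum p l3 d = wsum p l' d.
  move=> l'3 dq; apply: le_anti; apply/andP; split; last exact: wsum_le.
  rewrite /wsum (big_cat_nat _ l'3)//= [X in _ + X]big1_seq ?addr0//.
  move=> q /andP[/andP[_ /dq]]; rewrite mem_index_iota => ? /andP[]; lia.
exists l3, (fun k => if k == n then e else e1 k); split.
- by rewrite leq_max h1.
- move=> k q; rewrite ltnS leq_eqVlt => /orP[/eqP ->|kn].
    by rewrite eqxx => /e2[/andP[? ?] ?]; split => //; apply/andP; rewrite /l3; lia.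
  by rewrite ltn_eqF// => /(h2 _ _ kn)[/andP[? ?] ?]; split => //; apply/andP;
    rewrite /l3; lia.
- move=> k; rewrite ltnS leq_eqVlt => /orP[/eqP ->|kn].
    by rewrite eqxx (wsumE l2) ?leq_maxr// => q /e2[/andP[]].
  by rewrite ltn_eqF// (wsumE l1) ?leq_maxl ?h3// => q /(h2 _ _ kn)[/andP[]].
- move=> k k' q; rewrite !ltnS (leq_eqVlt k) (leq_eqVlt k').
  move=> /orP[/eqP ->|kn] /orP[/eqP ->|kn']; rewrite ?eqxx//.
  + by rewrite (ltn_eqF kn') => _ /e2[/andP[? _] _];
    apply/negP => /(h2 _ _ kn')[/andP[]]; lia.
  + by rewrite (ltn_eqF kn) => _ /(h2 _ _ kn)[/andP[? ?] _];
    apply/negP => /e2[/andP[]]; lia.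
  + by rewrite (ltn_eqF kn) (ltn_eqF kn'); exact: h4.
Qed.

(* Two disjoint candidates cannot both be close to the same f, so each of the n
   tests excludes at most one of the n + 1 candidates. *)
Lemma avoiding_copy j p l l' n (e : nat -> nat -> bool) (f : 'I_n -> nat -> bool) :
  (forall k q, (k < n.+1)%N -> e k q -> (l <= q)%N) ->
  (forall k, (k < n.+1)%N -> w j / 2 <= wsum p l' (e k)) ->
  (forall k k' q, (k < n.+1)%N -> (k' < n.+1)%N -> k != k' -> e k q -> ~~ e k' q) ->
  exists2 k, (k < n.+1)%N & forall i,
    w j / 2 <= wsum p l' (fun q => (l <= q)%N && (e k q != f i q)).
Proof.
move=> el ew ed; apply: contrapT => h.
have /choice[c cP] : forall k : 'I_n.+1, exists i : 'I_n,
    wsum p l' (fun q => (l <= q)%N && (e k q != f i q)) < w j / 2.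
  move=> k; apply: contrapT => h'; apply: h; exists k => // i.
  by rewrite leNgt; apply/negP => ?; apply: h'; exists i.
have /injectivePn[k [k' kk' ckk']] : ~~ injectiveb c.
  by apply/injectiveP => /leq_card; rewrite !card_ord ltnn.
have := @wsum_disjoint p l' l (e k) (e k') (f (c k)).
move=> H; have {H} : wsum p l' (e k) + wsum p l' (e k') <=
  wsum p l' (fun q => (l <= q)%N && (e k q != f (c k) q)) +
  wsum p l' (fun q => (l <= q)%N && (e k' q != f (c k) q)).
  apply: H => q; first exact: ed.
  by move=> /orP[]; exact: el.
have := cP k; have := cP k'; have := ew k (ltn_ord k); have := ew k' (ltn_ord k').
rewrite -ckk'; lra.
Qed.

Context (D : nat -> seq bool -> Prop) (g : nat -> option (guess P)).
Hypothesis D_dense : forall i, dense_open (D i).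
Hypothesis g_good : forall i ga, g i = Some ga -> good_guess ga.

Definition entered (Psi : seq bool -> seq bool) s (ga : guess P) :=
  prefix (guess_dom ga) (Psi s).

(* st_psi S s is the part of psi x settled for x extending s, st_len S its length,
   and st_val S s i what guess i has promised so far to such a point. *)
Record stage := Stage {
  st_len : nat;
  st_psi : seq bool -> seq bool;
  st_val : seq bool -> nat -> seq bool }.

(** A recorded promise comes from a [V] inside the settled part, so it is valid for every point
    extending that part. *)
Definition stage_inv j (S : stage) :=
  (forall s, size s = j -> size (st_psi S s) = st_len S) /\
  forall s i ga, size s = j -> (i < j)%N -> g i = Some ga ->
    entered (st_psi S) s ga ->
    exists2 V, prefix V (st_psi S s) & guess_val ga V (st_val S s i).

(** The last clause compares the promise made on bit 0 with the image on bit 1, for independent [s]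
    and [t], since the two points may have differed before [j]. *)
Definition stage_step j (e : nat -> bool) (S S' : stage) :=
  [/\ (st_len S < st_len S')%N,
    (forall q, e q -> (st_len S <= q < st_len S')%N /\ pos q = pos j),
    (forall p, pos j = Some p -> w j / 2 <= wsum p (st_len S') e <= w j),
    (forall s b, size s = j -> prefix (st_psi S s) (st_psi S' (rcons s b))) &
  [/\ (forall s t b c q, size s = j -> size t = j ->
      (st_len S <= q < st_len S')%N ->
      nth false (st_psi S' (rcons s b)) q (+) nth false (st_psi S' (rcons t c))
        q = (b (+) c) && e q),
    (forall s i, size s = j.+1 -> (i <= j)%N ->
      exists2 V, prefix V (st_psi S' s) & D i V),
    (forall s i ga b, size s = j -> (i < j)%N -> g i = Some ga ->
      entered (st_psi S) s ga ->
      prefix (st_val S s i) (st_val S' (rcons s b) i)) &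
    (forall s t i ga, size s = j -> size t = j -> (i < j)%N -> g i = Some ga ->
      entered (st_psi S) s ga -> pos j = Some (guess_pos ga) ->
      let v := st_val S' (rcons s false) i in
      w j / 2 <= wsum (guess_pos ga) (minn (size v) (st_len S'))
        (fun q => (st_len S <= q)%N &&
          (nth false (st_psi S' (rcons t true)) q != nth false v q)))]].

(** The order of choices matters. Disjoint candidate blocks come first; then a common tail [r],
    placed after the zeros written for bit 0, lengthens the promises to at least [l0]; only then is
    a candidate picked that is far from all of them. The promises do not depend on that pick. *)
Lemma guess_block j (S : stage) : stage_inv j S ->
  exists l0 (e : nat -> bool) (r : seq bool) (v : seq bool -> nat -> seq bool),
  let base s := st_psi S s ++ nseq (l0 - st_len S) false ++ r in
  [/\ (st_len S <= l0)%N,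
    (forall q, e q -> (st_len S <= q < l0)%N /\ pos q = pos j),
    (forall p, pos j = Some p -> w j / 2 <= wsum p l0 e <= w j) &
    (forall s i ga, size s = j -> (i < j)%N -> g i = Some ga ->
      entered (st_psi S) s ga -> pos j = Some (guess_pos ga) ->
      [/\ prefix (st_val S s i) (v s i), (l0 <= size (v s i))%N,
         exists2 V, prefix V (base s) & guess_val ga V (v s i) &
         w j / 2 <= wsum (guess_pos ga) l0
          (fun q => (st_len S <= q)%N && (e q != nth false (v s i) q))])].
Proof.
move=> [Ssz Sval]; case pj: (pos j) => [p|]; last first.
  by exists (st_len S), (fun=> false), [::], (fun _ _ => [::]); split.
(* There is one test for each node and guess, hence one more candidate than the size of [T]. *)
pose T := [seq (s, i) | s <- bitseqs j, i <- iota 0 j].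
have [l0 [e [h1 h2 h3 h4]]] := disjoint_copies (st_len S) (size T).+1 pj.
pose base0 (si : seq bool * nat) := st_psi S si.1 ++ nseq (l0 - st_len S) false.
pose Q (si : seq bool * nat) (u : seq bool) := forall ga, g si.2 = Some ga ->
  entered (st_psi S) si.1 ga -> exists V t, [/\ prefix V u,
    prefix (st_val S si.1 si.2) t,
    (l0 <= size t)%N & guess_val ga V t].
have [r rP] : exists r, forall si, si \in T -> Q si (base0 si ++ r).
  apply: common_tail; last first.
    move=> si u u' uu' Qu ga gi en; have [V [t [? ? ? ?]]] := Qu ga gi en.
    by exists V, t; split => //; exact: prefix_trans uu'.
  move=> [s i] /allpairsP[[s' i'] [/= ss ii [-> ->]]] u pu.
  move: ss ii; rewrite mem_bitseqs mem_iota add0n => /eqP ss ii {s i}.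
  have [[ga [gi en]]|nga] := pselect (exists ga, g i'
    = Some ga /\ entered (st_psi S) s' ga); last first.
    exists u; first exact: prefix_refl.
    by move=> ga gi en; exfalso; apply: nga; exists ga.
  have [V VS Vt] := Sval _ _ _ ss ii gi en.
  have [_ gg] := g_good gi.
  have [|V' [t' [uV' tt' lt' gv]]] := gg _ _ Vt u l0.
    by apply: prefix_trans VS (prefix_trans _ pu); exact: prefix_prefix.
  exists V' => // ga' /=; rewrite gi => -[<-] _.
  by exists V', t'; split => //; exact: prefix_refl.
have /choice[v vP] : forall si, exists t, si \in T -> forall ga, g si.2 = Some ga ->
  entered (st_psi S) si.1 ga -> exists V, [/\ prefix V (base0 si ++ r),
    prefix (st_val S si.1 si.2) t,
    (l0 <= size t)%N & guess_val ga V t].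
  move=> si; have [[ga [gi en]]|nga] := pselect (exists ga, g si.2
    = Some ga /\ entered (st_psi S) si.1 ga); last first.
    by exists [::] => _ ga gi en; exfalso; apply: nga; exists ga.
  have [siT|nsiT] := boolP (si \in T); last by exists [::].
  have [V [t ?]] := rP si siT ga gi en; exists t => _ ga'; rewrite gi => -[<-] _.
  by exists V.
have [k kn kP] := @avoiding_copy j p (st_len S) l0 (size T) e
  (fun i => nth false (v (nth ([::], 0%N) T i)))
  (fun k q kn ek => proj1 (andP (proj1 (h2 k q kn ek))))
  (fun k kn => proj1 (andP (h3 k kn))) h4.
exists l0, (e k), r, (fun s i => v (s, i)) => /=; split => //.
- by move=> q /(h2 _ _ kn).
- by move=> _ [<-]; exact: h3.
- move=> s i ga ss ij gi en [pg].
  have siT : (s, i) \in T by apply/allpairsP; exists (s, i);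
    rewrite mem_bitseqs mem_iota ss eqxx.
  have [V [v1 v2 v3 v4]] := vP _ siT ga gi en; split => //.
    by exists V => //; rewrite catA.
  have iT : (index (s, i) T < size T)%N by rewrite index_mem.
  by have := kP (Ordinal iT); rewrite /= nth_index// -pg.
Qed.

Lemma stage_next j (S : stage) : stage_inv j S ->
  exists e S', stage_inv j.+1 S' /\ stage_step j e S S'.
Proof.
move=> SI; have [Ssz Sval] := SI.
have [l0 [e [r [v /= [h1 h2 h3 h4]]]]] := guess_block SI.
pose l := st_len S.
pose base (sb : seq bool * bool) :=
  st_psi S sb.1 ++ mkseq (fun q => sb.2 && e (l + q)%N) (l0 - l) ++ r.
pose T := [seq (sb, i) | sb <- [seq (s, b) | s <- bitseqs j, b <- [:: true;
  false]], i <- iota 0 j.+1].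
(* A second common tail brings every node, for either new bit, into [D i] for all [i <= j]. *)
have [r2 r2P] : exists r2, forall sbi, sbi \in T ->
    (fun (sbi : seq bool * bool * nat) u => exists2 V,
      prefix V u & D sbi.2 V) sbi (base sbi.1 ++ r2).
  apply: (@common_tail _ T (fun sbi => base sbi.1)
    (fun sbi u => exists2 V, prefix V u & D sbi.2 V)).
    move=> sbi _ u _; have [V uV DV] := D_dense sbi.2 u.
    by exists V => //; exists V => //; exact: prefix_refl.
  by move=> sbi u u' uu' [V Vu DV]; exists V => //; exact: prefix_trans uu'.
have /choice[t0 t0P] : forall i, exists t, forall ga, g i = Some ga ->
    guess_val ga (guess_dom ga) t.
  move=> i; case gi: (g i) => [ga|]; last by exists [::].
  by have [[t ?] _] := g_good gi; exists t => _ [<-].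
(* The extra bit [false] in [Psi] makes the length grow even when block and tails are empty. *)
pose l' := (l0 + size r + size r2).+1.
pose Psi s := base (take j s, nth false s j) ++ r2 ++ [:: false].
(* The longer promise [v] is valid only after the zeros of bit 0, and is used in the guess's own
   fibre. Other guesses being followed keep their promise, and one not yet taken up gets [t0]. *)
pose T' s i := if g i is Some ga then
    if (i < j)%N && prefix (guess_dom ga) (st_psi S (take j s)) then
      if ~~ nth false s j && (pos j == Some (guess_pos ga)) then v (take j s) i
      else st_val S (take j s) i
    else t0 i
  else [::].
have rj (s : seq bool) b : size s = j -> (take j (rcons s b)
  = s) * (nth false (rcons s b) j = b).
  by move=> ss; rewrite -cats1 take_size_cat// nth_cat ss ltnn subnn.
have PsiE s b : size s = j -> Psi (rcons s b) = base (s, b) ++ r2 ++ [:: false].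
  by move=> ss; rewrite /Psi !rj.
have szj (s : seq bool) : size s = j.+1 -> exists s' b, s
  = rcons s' b /\ size s' = j.
  case/lastP: s => // s' b; rewrite size_rcons => -[ss]; by exists s', b.
have lP s b : size s = j -> prefix (st_psi S s) (Psi (rcons s b)).
  by move=> ss; rewrite PsiE// /base -!catA prefix_prefix.
have sbase s b : size s = j -> size (base (s, b)) = (l0 + size r)%N.
  by move=> ss; rewrite /base !size_cat size_mkseq Ssz// -/l; lia.
have sPsi s b : size s = j -> size (Psi (rcons s b)) = l'.
  by move=> ss; rewrite PsiE// size_cat sbase// size_cat /= /l'; lia.
have nPsi s b q : size s = j -> (l <= q < l')%N ->
    nth false (Psi (rcons s b)) q = if (q < l0)%N then b && e q
      else nth false (r ++ r2 ++ [:: false]) (q - l0).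
  move=> ss /andP[lq ql']; rewrite PsiE// /base -!catA nth_cat Ssz// -/l ltnNge
    lq /=.
  rewrite nth_cat size_mkseq; have -> : (q - l < l0 - l)%N = (q < l0)%N by lia.
  case: ifPn => ql0; first by rewrite nth_mkseq ?subnKC//; lia.
  by congr nth; lia.
exists e, (Stage l' Psi T'); split.
  split => [s /szj[s' [b [-> ss]]]|s i ga /szj[s' [b [-> ss]]] _ gi en] /=;
    first exact: sPsi.
  rewrite /T' gi !rj//; case: ifPn => [/andP[ij en']|_]; last first.
    by exists (guess_dom ga); [exact: en|exact: t0P].
  case: ifPn => [/andP[/negbTE b0 /eqP pj]|_]; last first.
    have [V Vp gv] := Sval _ _ _ ss ij gi en'.
    by exists V => //; exact: prefix_trans (lP _ _ ss).
  have [_ _ [V VP gv] _] := h4 _ _ _ ss ij gi en' pj.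
  exists V => //; apply: (prefix_trans VP); rewrite b0 PsiE// /base/=.
  have -> : mkseq (fun=> false) (l0 - l) = nseq (l0 - l) false.
    by apply: (@eq_from_nth _ false); rewrite size_mkseq ?size_nseq// => q ql;
      rewrite nth_mkseq// nth_nseq if_same.
  exact: prefix_prefix.
split => /=.
- by rewrite /l' ltnS -!addnA; apply: leq_trans h1 _; rewrite leq_addr.
- by move=> q /h2[/andP[? ?] ?]; split => //; apply/andP; rewrite /l'; lia.
- move=> p pj; have /andP[e1 e2] := h3 p pj.
  have -> : wsum p l' e = wsum p l0 e; last by rewrite e1.
  apply: le_anti; apply/andP; split; last by apply: wsum_le => //; rewrite /l'; lia.
  rewrite {1}/wsum (@big_cat_nat _ _ _ l0)//=; last by rewrite /l'; lia.
  rewrite [X in _ + X]big1_seq ?addr0//.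
  by move=> q /andP[/andP[_ /h2[/andP[_ ql] _]]]; rewrite mem_index_iota leqNgt ql.
- exact: lP.
split => /=.
- move=> s t b c q ss tt lq; rewrite !nPsi//; case: ifPn => [_|ql0];
    first by rewrite andb_addl.
  rewrite addbb; apply/esym/negbTE; rewrite negb_and orbC; apply/orP; left.
  by apply: contra ql0 => /h2[/andP[]].
- move=> s i /szj[s' [b [-> ss]]] ij; rewrite PsiE//.
  have [] := r2P ((s', b), i); last first.
    by move=> V VP DV; exists V => //; apply: prefix_trans VP _;
      rewrite catA prefix_prefix.
  apply/allpairsP; exists ((s', b), i); rewrite mem_iota ltnS ij; split => //.
  by apply/allpairsP; exists (s', b); rewrite mem_bitseqs ss eqxx; split => //;
    case: (b).
- move=> s i ga b ss ij gi en; rewrite /T' gi !rj// ij /=;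
    rewrite /entered in en; rewrite en.
  case: ifPn => [/andP[_ /eqP pj]|_]; last exact: prefix_refl.
  by have [] := h4 _ _ _ ss ij gi en pj.
- move=> s t i ga ss tt ij gi en pj.
  have [_ sv _ wv] := h4 _ _ _ ss ij gi en pj.
  rewrite /T' gi !rj// ij /=; rewrite /entered in en; rewrite en pj eqxx /=.
  apply: le_trans wv _; apply: wsum_le => //.
    by rewrite leq_min sv /l'; lia.
  move=> q ql0 /andP[lq]; rewrite lq nPsi// ?ql0 ?lq//=; rewrite /l'; lia.
Qed.

(** * The limit of the stages *)

Definition diverges p (A : nat -> bool) := forall m : nat,
  exists N, m%:R <= wsum p N A.

(** For the last clause: each late [j] in the guess's fibre with [x j] false and [y j] true adds at
    least [w j / 2] to the weight on which [psi y] differs from the promises made to [psi x]. These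
    contributions lie in disjoint intervals, so no bound survives. *)
Lemma escape : (forall q, 0 < w q) ->
  exists (psi : (nat -> bool) -> nat -> bool) (l : nat -> nat),
  [/\ (forall n, n <= l n)%N /\
      (forall x y n, mkseq x n = mkseq y n -> forall q, (q < l n)%N ->
        psi x q = psi y q),
    (forall x y, (forall q, pos q <> None -> psi x q = psi y q) ->
       forall j, pos j <> None -> x j = y j),
    (forall x y p, separated pos w p (psi x) (psi y) -> separated pos w p x y),
    (forall x y p, (forall j, pos j = Some p -> x j = y j) ->
      forall q, pos q = Some p -> psi x q = psi y q) &
    (forall x i, meets (D i) (psi x)) /\
    (forall x y i ga, g i = Some ga ->
       diverges (guess_pos ga) (fun j => ~~ x j && y j) ->
         ~ captured ga (psi x) (psi y))].
Proof.
move=> w_gt0.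
have /choice[next nextP] : forall jS : nat * stage, exists eS : (nat ->
  bool) * stage,
    stage_inv jS.1 jS.2 -> stage_inv jS.1.+1 eS.2 /\ stage_step jS.1 eS.1 jS.2 eS.2.
  move=> [j S]; have [SI|nSI] := pselect (stage_inv j S);
    last by exists (fun=> false, S).
  by have [e [S' ?]] := stage_next SI; exists (e, S').
pose st := fix st n := if n is n'.+1 then (next (n', st n')).2
  else Stage 0 (fun=> [::]) (fun _ _ => [::]).
pose e n := (next (n, st n)).1.
have stI n : stage_inv n (st n).
  by elim: n => [|n ih]; [split => // s i ga _|have [] := nextP (n, st n) ih].
have stS n : stage_step n (e n) (st n) (st n.+1) by have [] :=
  nextP (n, st n) (stI n).
pose l n := st_len (st n); pose Psi n x := st_psi (st n) (mkseq x n).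
have lS n : (l n < l n.+1)%N by have [] := stS n.
have nl n : (n <= l n)%N by elim: n => // n ih; exact: leq_ltn_trans (lS n).
have sPsi n x : size (Psi n x) = l n by have [h _] := stI n;
  rewrite /Psi h// size_mkseq.
have PsiS n x : prefix (Psi n x) (Psi n.+1 x).
  by rewrite /Psi mkseqS; have [_ _ _ h _] := stS n; apply: h; rewrite size_mkseq.
have /choice[psi psiP] : forall x, exists a, forall n, cyl (Psi n x) a.
  move=> x; apply: (nat_limit false) => // n; exists n; by rewrite sPsi.
have block q : exists n, (l n <= q < l n.+1)%N.
  have : (q < l q.+1)%N by exact: nl.
  elim: {2}q => [|k ih]; first by exists 0%N.
  have [lk lk'|lk _] := leqP (l k.+1) q; last exact: ih.
  by exists k.+1; rewrite lk lk'.
have psiD x y n q : (l n <= q < l n.+1)%N -> psi x q (+) psi y q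
  = (x n (+) y n) && e n q.
  move=> lq; have /(cylP _ _ false) hx := psiP x n.+1.
  have /(cylP _ _ false) hy := psiP y n.+1.
  rewrite -hx ?sPsi ?(andP lq).2// -hy ?sPsi ?(andP lq).2//.
  by rewrite /Psi !mkseqS; have [_ _ _ _ [h _ _ _]] := stS n; apply: h;
    rewrite ?size_mkseq.
have psiE x y n q : (l n <= q < l n.+1)%N -> x n = y n -> psi x q = psi y q.
  by move=> lq xy; apply/eqP; have := psiD x y n q lq; rewrite xy addbb;
    case: (psi x q); case: (psi y q).
(* Between [l n] and [l n.+1] images differ only on [e n], and only if [x n] and [y n] differ; [e n]
   lies in the fibre of [n] and weighs at most [w n]. *)
have wpsi x y p n : wsum p (l n) (fun q => psi x q != psi y q)
  <= wsum p n (fun j => x j != y j).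
  elim: n => [|n ih]; first by rewrite /wsum !big_geq.
  rewrite /wsum (@big_cat_nat _ _ _ (l n)) ?(ltnW (lS n))//= (@big_cat_nat _ _
    _ n 0%N n.+1)//=.
  apply: lerD => //; rewrite [leRHS]big_mkcond big_nat1.
  case: ifPn => [/andP[/eqP pn xy]|nxy].
    have [_ _ h _ _] := stS n; have /andP[_ +] := h p pn; apply: le_trans.
    rewrite /wsum (@big_cat_nat _ _ _ (l n) 0%N (l n.+1)) ?(ltnW (lS n))//=
      -[leLHS]add0r.
    apply: lerD; first exact: sumr_ge0.
    rewrite big_nat_cond [leRHS]big_nat_cond big_mkcond [leRHS]big_mkcond /=.
    apply: ler_sum => q _; case lq: (l n <= q < l n.+1)%N => //=.
    case: (pos q == Some p) => //=.
    have := psiD x y _ _ lq; case: (e n q); last first.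
      by rewrite andbF; case: (psi x q); case: (psi y q).
    by case: ifP.
  rewrite big1_seq// => q /andP[/andP[pq pxy]]; rewrite mem_index_iota => lq.
  have := psiD x y _ _ lq; have [_ h _ _ _] := stS n.
  move: nxy; rewrite negb_and negbK; case: (e n q) (h q) => [h'|_].
    have [_ pqn] := h' isT; move: pq; rewrite pqn => -> /= /eqP ->.
    by rewrite addbb; move: pxy; case: (psi x q); case: (psi y q).
  by rewrite andbF; move: pxy; case: (psi x q); case: (psi y q).
exists psi, l; split.
- split=> // x y n xy q qn.
  have [k kq] := block q.
  apply: (psiE _ _ k) => //.
  have kn : (k < n)%N.
    rewrite ltnNge; apply/negP => nk; suff : (l n <= l k)%N by lia.
    by rewrite -(subnK nk); elim: (k - n)%N => // i ih;
      apply: leq_trans ih (ltnW _); rewrite addSn.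
  by have := congr1 (nth false ^~ k) xy; rewrite /= !nth_mkseq.
- move=> x y xy j; case pj: (pos j) => [p|//] _.
  apply/eqP; apply: contraT => xyj.
  have [_ h1 h2 _ _] := stS j; have /andP[+ _] := h2 p pj.
  suff -> : wsum p (st_len (st j.+1)) (e j) = 0 by have := w_gt0 j; lra.
  rewrite /wsum big1_seq// => q /andP[/andP[_ ej] _]; have [lq pq] := h1 q ej.
  by have := psiD x y _ _ lq; rewrite ej xy ?pq ?pj// addbb andbT; move: xyj;
    case: (x j); case: (y j).
- move=> x y p sxy m; have [N mN] := sxy m; exists N; apply: le_trans mN _.
  by apply: le_trans (wpsi x y p N); exact: wsum_le.
- move=> x y p xy q pq; have [n nq] := block q.
  have [_ h _ _ _] := stS n; have := psiD x y _ _ nq.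
  case: (e n q) (h q) => [/(_ isT)[_ pn]|_].
    rewrite xy; last by rewrite -pn.
    by rewrite addbb; case: (psi x q); case: (psi y q).
  by rewrite andbF; case: (psi x q); case: (psi y q).
split.
- move=> x i; have [_ _ _ _ [_ h _ _]] := stS i.
  have [||V VP DV] := h (mkseq x i.+1) i; rewrite ?size_mkseq//.
  by exists V => //; apply: cyl_prefix VP _; exact: psiP.
move=> x y i ga gi dv [xU cap].
pose p := guess_pos ga.
(* From [j0] on, guess [i] is followed and its domain has been entered, as [n <= l n]. *)
pose j0 := maxn i.+1 (size (guess_dom ga)).
have ent n : (j0 <= n)%N -> entered (st_psi (st n)) (mkseq x n) ga.
  move=> nj; apply: cyl_size_prefix xU (psiP x n) _.
  by rewrite sPsi (leq_trans _ (nl n))// (leq_trans _ nj)// leq_maxr.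
pose t n := st_val (st n) (mkseq x n) i.
have ij n : (j0 <= n)%N -> (i < n)%N by apply: leq_trans; rewrite leq_maxl.
have tS n : (j0 <= n)%N -> prefix (t n) (t n.+1).
  move=> jn; have [_ _ _ _ [_ _ h _]] := stS n; rewrite /t mkseqS; apply: h => //.
  - by rewrite size_mkseq.
  - exact: ij.
  - exact: gi.
  - exact: ent.
(* Old differences survive because promises only lengthen; new ones lie beyond [l k], and
   [wsum_split] adds the two. *)
have sumt n : wsum p (j0 + n) (fun j => ~~ x j && y j) / 2 <=
    wsum p j0 (fun j => ~~ x j && y j) / 2 +
    wsum p (minn (size (t (j0 + n)%N)) (l (j0 + n)%N)) (fun q =>
      psi y q != nth false (t (j0 + n)%N) q).
  elim: n => [|n ih]; first by rewrite addn0 lerDl; exact: wsum_ge0.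
  rewrite addnS; set k := (j0 + n)%N in ih *;
    have jk : (j0 <= k)%N by rewrite leq_addr.
  have tk := tS k jk.
  have mm : (minn (size (t k)) (l k) <= minn (size (t k.+1)) (l k.+1))%N.
    by rewrite leq_min !geq_min size_prefix// (ltnW (lS k)) orbT.
  have tE q : (q < minn (size (t k)) (l k))%N -> psi y q != nth false (t k) q ->
      psi y q != nth false (t k.+1) q.
    by rewrite ltn_min => /andP[qt _]; rewrite (prefix_nth _ tk).
  have -> : wsum p k.+1 (fun j => ~~ x j && y j) = wsum p k (fun j =>
    ~~ x j && y j) +
      (if (pos k == Some p) && (~~ x k && y k) then w k else 0).
    by rewrite /wsum big_mkcond big_nat_recr//= -big_mkcond.
  have [/andP[/eqP pk /andP[xk yk]]|_] := ifPn; last first.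
    rewrite addr0; apply: le_trans ih _; rewrite lerD2l; exact: wsum_le.
  have sp := wsum_split p mm (geq_minr _ _) tE.
  rewrite mulrDl; apply: le_trans (lerD ih (lexx _)) _.
  rewrite -addrA lerD2l; apply: le_trans sp; rewrite lerD2l.
  have [_ _ _ _ [_ _ _ h]] := stS k.
  have := h (mkseq x k) (mkseq y k) i ga (size_mkseq _ _) (size_mkseq _ _) (ij
    _ jk) gi (ent k jk) pk.
  have -> : rcons (mkseq x k) false = mkseq x k.+1 by rewrite mkseqS (negbTE xk).
  have -> : rcons (mkseq y k) true = mkseq y k.+1 by rewrite mkseqS yk.
  move=> /= {}h; apply: le_trans h _; apply: wsum_le => // q.
  rewrite ltn_min => /andP[_ ql]; have /(cylP _ _ false) <- := psiP y k.+1;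
    last by rewrite sPsi.
  by [].
pose c := wsum p j0 (fun j => ~~ x j && y j) / 2.
have c0 : 0 <= c by rewrite divr_ge0// wsum_ge0.
(* [Num.bound c] absorbs the weight below [j0], and the factor 2 the loss of one half. *)
have [N mN] := dv (2 * (guess_bound ga + Num.bound c))%N.
have := sumt N; set n := (j0 + N)%N => sn.
have := archi_boundP c0; have := cap _ (t n).
have [_ /(_ (mkseq x n) i ga (size_mkseq _ _))] := stI n.
have jn : (j0 <= n)%N by rewrite leq_addr.
move=> /(_ (ij _ jn) gi (ent n jn)) [V Vp gv] /(_ V gv (cyl_prefix Vp (psiP x n))).
have : wsum p (minn (size (t n)) (l n)) (fun q => psi y q != nth false (t n) q)
   <= wsum p (size (t n)) (fun q => psi y q != nth false (t n) q).
  by apply: wsum_le => //; rewrite geq_minl.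
have : wsum p N (fun j => ~~ x j && y j) <= wsum p n (fun j => ~~ x j && y j).
  by apply: wsum_le => //; rewrite leq_addl.
move: mN sn; rewrite natrM natrD -/c -/p; lra.
Qed.

End Escape.

(** * Weights over a countable index set *)

(* Projections of closed sets, closedness being spelled out by finite
   approximations. *)
Definition analytic (T : countType) (A : (T -> bool) -> Prop) :=
  exists C : (T -> bool) -> (nat -> nat) -> Prop,
    (forall x v, (forall (s : seq T) n, exists x' v', [/\ C x' v', {in s, x' =1 x} &
        forall i, (i < n)%N -> v' i = v i]) -> C x v) /\
    forall x, A x <-> exists v, C x v.

Definition analytic_rel (T : countType) (F : (T -> bool) -> (T -> bool) -> Prop) :=
  analytic (fun xy : T + T -> bool => F (xy \o inl) (xy \o inr)).

Section WeightedFamilies.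
Context {R : archiRealFieldType} {P : eqType} {S : countType} (pos : S -> P).
Context (w : S -> R).

Definition large_weight p (B : S -> bool) := forall m : nat, exists s : seq S,
  [/\ uniq s, forall z, z \in s -> pos z = p /\ B z & m%:R <= \sum_(z <- s) w z].

Definition wseparated p (x y : S -> bool) := large_weight p (fun z => x z != y z).

Lemma large_weight_sub p (A B : S -> bool) : (forall z, pos z = p -> A z -> B z) ->
  large_weight p A -> large_weight p B.
Proof.
move=> AB lA m; have [s [us sA ms]] := lA m; exists s; split => // z /sA[pz Az].
by split => //; exact: AB.
Qed.

(** If the finite sums over [A] and [B] stay below [m1] and [m2], those over the union stay below
    [m1 + m2]. *)
Lemma large_weightU p (A B : S -> bool) : large_weight p (fun z => A z || B z) ->
  large_weight p A \/ large_weight p B.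
Proof.
move=> lAB; apply: contrapT => /not_orP[nA nB].
have [m1 m1P] : exists m1 : nat, forall s, uniq s -> (forall z, z \in s ->
  pos z = p /\ A z) ->
    \sum_(z <- s) w z < m1%:R.
  apply: contrapT => h; apply: nA => m; apply: contrapT => h'; apply: h;
    exists m => s us sA.
  by rewrite ltNge; apply/negP => ms; apply: h'; exists s.
have [m2 m2P] : exists m2 : nat, forall s, uniq s -> (forall z, z \in s ->
  pos z = p /\ B z) ->
    \sum_(z <- s) w z < m2%:R.
  apply: contrapT => h; apply: nB => m; apply: contrapT => h'; apply: h;
    exists m => s us sB.
  by rewrite ltNge; apply/negP => ms; apply: h'; exists s.
have [s [us sAB]] := lAB (m1 + m2)%N; rewrite leNgt => /negP; apply.
rewrite (bigID A) /= natrD -[X in X + _]big_filter -[X in _ + X]big_filter;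
  apply: ltrD.
  apply: m1P; first exact: filter_uniq.
  by move=> z; rewrite mem_filter => /andP[Az /sAB[]].
apply: m2P; first exact: filter_uniq.
move=> z; rewrite mem_filter => /andP[/negbTE nAz /sAB[pz]].
by rewrite nAz.
Qed.

(* Inside each fibre of pos, every weight can be reproduced within a factor of 2
   arbitrarily far out. *)
Definition repeating := forall j n, exists s : seq S,
  [/\ uniq s, forall z, z \in s -> pos z = pos j /\ (n <= pickle z)%N &
      w j / 2 <= \sum_(z <- s) w z <= w j].

End WeightedFamilies.

(** * Transfer between a countable index set and the natural numbers *)

Section Coding.
Context {R : archiRealFieldType} {P S : countType} (pos : S -> P).
Context (w : S -> R) (w_gt0 : forall z, 0 < w z).

(** [pickle_inv] is defined exactly on codes, so no two numbers stand for the same position. *)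
Definition code_pos (q : nat) := omap pos (@pickle_inv S q).
(** The default 1 keeps weights positive at numbers that code nothing; these lie in no fibre and
    enter no sum. *)
Definition code_weight (q : nat) := oapp w 1 (@pickle_inv S q).
Definition code_ext (x : S -> bool) (q : nat) := oapp x false (@pickle_inv S q).

Lemma code_weight_gt0 q : 0 < code_weight q.
Proof. by rewrite /code_weight; case: pickle_inv => //=. Qed.

Local Notation wsum := (wsum code_pos code_weight).

Lemma wsum_code p N (A : nat -> bool) : wsum p N A =
  \sum_(z <- pmap (@pickle_inv S) (iota 0 N) | (pos z == p) && A (pickle z)) w z.
Proof.
rewrite /wsum [RHS]big_mkcond big_pmap [LHS]big_mkcond /index_iota subn0.
apply: eq_bigr => q _; rewrite /code_pos /code_weight.
have := @pickle_invK S q; case: pickle_inv => //= z ->.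
by rewrite (inj_eq Some_inj).
Qed.

Lemma mem_pmap_pickle (z : S) N : (z \in pmap (@pickle_inv S) (iota 0 N))
  = (pickle z < N)%N.
Proof.
rewrite mem_pmap; apply/mapP/idP => [[q]|zN].
  rewrite mem_iota add0n => qN h; have := @pickle_invK S q;
    rewrite -h /= => ->; exact: qN.
by exists (pickle z); rewrite ?pickleK_inv// mem_iota.
Qed.

Lemma wsum_seq p N (s : seq S) : uniq s ->
  (forall z, z \in s -> pos z = p /\ (pickle z < N)%N) ->
  wsum p N (mem (map pickle s)) = \sum_(z <- s) w z.
Proof.
move=> us sP; rewrite wsum_code -big_filter; apply: perm_big;
  apply: uniq_perm => //.
  by apply: filter_uniq; apply: pmap_uniq (iota_uniq _ _); exact: pickle_invK.
move=> z; rewrite mem_filter mem_pmap_pickle /=.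
rewrite mem_map; last exact: (pcan_inj pickleK_inv).
by case: (boolP (z \in s)) => [/sP[-> ->]|_]; rewrite ?eqxx ?andbF.
Qed.

Lemma pickle_bound (s : seq S) : exists N, forall z, z \in s -> (pickle z < N)%N.
Proof.
exists (\max_(z <- s) (pickle z).+1)%N => z zs.
exact: (@bigmaxn_sup_seq _ _ z).
Qed.

Lemma divergesE p (A : nat -> bool) :
  diverges code_pos code_weight p A <-> large_weight pos w p (A \o pickle).
Proof.
split=> h m.
  have [N] := h m; rewrite wsum_code => mN.
  exists [seq z <- pmap (@pickle_inv S) (iota 0 N) | (pos z == p) && A (pickle z)].
  rewrite big_filter; split => //.
    by apply: filter_uniq; apply: pmap_uniq (iota_uniq _ _); exact: pickle_invK.
  by move=> z; rewrite mem_filter => /andP[/andP[/eqP]].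
have [s [us sP ms]] := h m; have [N sN] := pickle_bound s.
exists N; apply: le_trans ms _.
rewrite -(@wsum_seq p N) //; last by move=> z zs; have [] := sP z zs;
  split => //; exact: sN.
apply: wsum_le => [q|//|q _ /mapP[z /sP[_ ?] ->]//].
exact/ltW/code_weight_gt0.
Qed.

Lemma repeating_copies : repeating pos w -> small_copies code_pos code_weight.
Proof.
move=> rep q p l; rewrite /code_pos; case jq : (@pickle_inv S q) => [j|//] [<-].
have [s [us sP sw]] := rep j l; have [N sN] := pickle_bound s.
exists N, (mem (map pickle s)); split.
  by move=> _ /mapP[z zs ->]; rewrite pickleK_inv/= sN// andbT;
    have [-> ->] := sP z zs.
rewrite /= wsum_seq//; first by rewrite /code_weight jq.
by move=> z zs; rewrite sN//; have [->] := sP z zs.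
Qed.

End Coding.

Lemma agree_below (T : countType) n :
  exists s : seq T, forall z, (pickle z < n)%N -> z \in s.
Proof.
by exists (pmap (@pickle_inv T) (iota 0 n)) => z zn; rewrite mem_pmap_pickle.
Qed.

(** Both analytic conditions are packed into one closed [Y]. The last hypothesis excludes the family
    given by [not_small_perfect], so [Y] is small and [escape] applies to its guesses. *)
Theorem generic_embedding (R : archiRealFieldType) (P S : countType) (pos : S -> P)
    (w : S -> R) (F : (S -> bool) -> (S -> bool) -> Prop)
    (pos_sets : (P -> bool) -> Prop) :
  (forall z, 0 < w z) -> repeating pos w ->
  analytic_rel F -> analytic pos_sets ->
  (forall a (b : (nat -> bool) -> S -> bool) (A : (nat -> bool) -> P -> bool),
     (forall r, F a (b r)) -> (forall r, pos_sets (A r)) ->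
     ~ forall r r' p, r <> r' -> A r p -> wseparated pos w p (b r) (b r')) ->
  exists phi : (S -> bool) -> S -> bool,
  [/\ (forall z, exists s : seq S, forall x y, {in s, x =1 y} ->
        phi x z = phi y z) /\
      injective phi,
    (forall x y p, wseparated pos w p (phi x) (phi y) -> wseparated pos w p x y),
    (forall x y p, (forall z, pos z = p -> x z = y z) ->
       forall z, pos z = p -> phi x z = phi y z) &
    (forall x y A, pos_sets A -> (forall p, A p ->
      large_weight pos w p (fun z => ~~ x z && y z)) ->
      ~ F (phi x) (phi y))].
Proof.
move=> w_gt0 rep [CF [CF_closed CFP]] [CJ [CJ_closed CJP]] no_perfect.
have w_ge0 q : 0 <= code_weight w q by exact/ltW/code_weight_gt0.
(* y n packs bit n of b, bit n of A and entry n of the witness for each. *)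
pose K : countType := (bool * bool * nat * nat)%type.
pose join (a b : nat -> bool) (z : S + S) :=
  match z with inl z => a (pickle z) | inr z => b (pickle z) end.
pose Y (a : nat -> bool) (y : nat -> K) :=
  CF (join a (fun q => (y q).1.1.1)) (fun n => (y n).1.2) /\
  CJ (fun p => (y (pickle p)).1.1.2) (fun n => (y n).2).
have Y_closed a y : (forall n, exists a' y', [/\ Y a' y', cyl (mkseq a n) a' &
    cyl (mkseq y n) y']) -> Y a y.
  move=> h; split; [apply: CF_closed|apply: CJ_closed] => s n.
    have [N sN] : exists N, forall z : S + S, z \in s ->
        (match z with inl z => pickle z | inr z => pickle z end < N)%N.
      exists (\max_(z <- s) (match z with inl z => pickle z | inr z =>
        pickle z end).+1)%N => z zs.
      exact: (@bigmaxn_sup_seq _ _ z).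
    have [a' [y' [[CF' _] /(cylP _ _ false) aa' /(cylP _ _ (y 0)) yy']]] :=
      h (maxn n N).
    rewrite size_mkseq in aa'; rewrite size_mkseq in yy'.
    exists (join a' (fun q => (y' q).1.1.1)), (fun n => (y' n).1.2); split => //.
      move=> z /sN; case: z => z zN /=.
        by rewrite -aa' ?nth_mkseq// leq_max zN orbT.
      by rewrite -yy' ?nth_mkseq// leq_max zN orbT.
    by move=> i ni; rewrite -yy' ?nth_mkseq// leq_max ni.
  have [N sN] := pickle_bound s.
  have [a' [y' [[_ CJ'] /(cylP _ _ false) aa' /(cylP _ _ (y 0)) yy']]] :=
    h (maxn n N).
  rewrite size_mkseq in aa'; rewrite size_mkseq in yy'.
  exists (fun p => (y' (pickle p)).1.1.2), (fun n => (y' n).2); split => //.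
    by move=> z /sN zN; rewrite -yy' ?nth_mkseq// leq_max zN orbT.
  by move=> i ni; rewrite -yy' ?nth_mkseq// leq_max ni.
have smallY : small (code_pos pos) (code_weight w) (fun k : K =>
  k.1.1.1) (fun k : K => k.1.1.2) Y.
  apply: contrapT => /(not_small_perfect w_ge0 Y_closed)[a [y [yY ysep]]].
  apply: (no_perfect (a \o pickle) (fun r => (fun q => (y r q).1.1.1) \o pickle)
    (fun r p => (y r (pickle p)).1.1.2)).
  - move=> r; have [CFr _] := yY r.
    by apply/(CFP (join a (fun q => (y r q).1.1.1))); exists (fun n => (y r n).1.2).
  - by move=> r; apply/CJP; have [_] := yY r; exists (fun n => (y r n).2).
  - move=> r r' p rr' Arp; have := ysep r r' p rr' Arp.
    by move=> /(divergesE pos w_gt0).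
have [D [g [dD gg gY]]] := smallY.
have [psi [l [[nl psi_cont] psi_inj psi_sep psi_eq [psi_meets psi_capt]]]] :=
  escape w_ge0 (repeating_copies rep) dD gg (code_weight_gt0 w_gt0).
pose phi (x : S -> bool) (z : S) := psi (code_ext x) (pickle z).
have extK (x : S -> bool) z : code_ext x (pickle z) = x z
  by rewrite /code_ext pickleK_inv.
exists phi; split; first split.
- move=> z; have [s sP] := agree_below S (pickle z).+1; exists s => x y xy.
  apply: (psi_cont _ _ (pickle z).+1); last exact: nl.
  apply/(@eq_from_nth _ false) => [|q]; rewrite !size_mkseq// => qz.
  rewrite !nth_mkseq// /code_ext; have := @pickle_invK S q.
  by case: pickle_inv => //= z' z'q; apply: xy; apply: sP; rewrite z'q.
- move=> x y xy; apply: funext => z; rewrite -(extK x) -(extK y).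
  apply: psi_inj; last by rewrite /code_pos pickleK_inv.
  move=> q; have := @pickle_invK S q; rewrite /code_pos.
  case: pickle_inv => [z' /= <- _|_ /(_ erefl)//].
  exact: (congr1 (fun f : S -> bool => f z') xy).
- move=> x y p /(divergesE pos w_gt0 p (fun q =>
    psi (code_ext x) q != psi (code_ext y) q)).
  move=> /psi_sep /(divergesE pos w_gt0); apply: large_weight_sub => z _ /=.
  by rewrite !extK.
- move=> x y p xy z pz; apply: (psi_eq _ _ p);
    last by rewrite /code_pos pickleK_inv/= pz.
  move=> q; rewrite /code_pos /code_ext; case: pickle_inv => //= z' [] /xy //.
- move=> x y A pA Adiv Fxy.
  have /CFP[v vP] : F (join (psi (code_ext x)) (psi (code_ext y)) \o inl)
    (join (psi (code_ext x)) (psi (code_ext y)) \o inr) by exact: Fxy.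
  have /CJP[u uP] := pA.
  (* The image of [y], the set [A] and the witnesses form a point of [Y] over the image of [x]; some
     guess would capture it on a fibre of [A], which [psi_capt] forbids. *)
  pose yy n : K := (psi (code_ext y) n, oapp A false (@pickle_inv P n), v n, u n).
  have := gY (psi (code_ext x)) yy; case.
  + split; first exact: vP.
    by have -> : (fun p => (yy (pickle p)).1.1.2) = A by apply: funext => p;
      rewrite /yy /= pickleK_inv.
  + exact: psi_meets.
  + move=> i [ga [gi]]; rewrite /yy /= pickleK_inv /= => /Adiv Ad.
    apply: (psi_capt _ _ _ _ gi); apply/(divergesE pos w_gt0).
    by apply: large_weight_sub Ad => z _ /=; rewrite !extK.
Qed.

(** * Descriptive topology *)

(** The sets with this property form a filter, and it converges to [x] in each coordinate, hence in
    the pointwise topology. *)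
Lemma nbhs_ptws_agree (T : choiceType) (V : topologicalType) (x : {ptws T -> V}) U :
  nbhs x U -> exists s : seq T, forall y, {in s, y =1 x} -> U y.
Proof.
pose G : set_system {ptws T -> V} := [set U | exists s : seq T, forall y,
  {in s, y =1 x} -> U y].
have FG : Filter G.
  split; first by exists [::].
    move=> A B [s sA] [t tB]; exists (s ++ t) => y yx.
    by split; [apply: sA|apply: tB] => z zs; apply: yx; rewrite mem_cat zs ?orbT.
  by move=> A B AB [s sA]; exists s => y /sA /AB.
suff : G --> x by apply.
apply/cvg_sup => i; rewrite cvg_image; last by rewrite eqEsubset;
  split=> v // _; exists (cst v).
move=> W Wx /=; exists ((fun f : T -> V => f i) @^-1` W).
  exists [:: i] => y yx; rewrite /= yx ?mem_head//; exact: nbhs_singleton.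
by rewrite eqEsubset; split => [j [? + <-//]|j Wj]; exists (fun _ => j).
Qed.

Lemma nbhs_ptws_eq (T : choiceType) (x : {ptws T -> bool}) (s : seq T) :
  nbhs x [set y : {ptws T -> bool} | {in s, y =1 x}].
Proof.
elim: s => [|i s ih]; first by apply: filterS filterT.
have hi : nbhs x [set y : {ptws T -> bool} | y i = x i].
  by apply: (@proj_continuous T (fun=> bool) i x [set b | b = x i]).
apply: filterS (filterI hi ih) => y [/= yi ys] z.
by rewrite in_cons => /orP[/eqP ->|/ys].
Qed.

Lemma closed_agree (X : topologicalType) (C : set X) (x : X) : closed C ->
  (forall U, nbhs x U -> exists2 y, C y & U y) -> C x.
Proof. by rewrite closedE => cC h; apply: cC => nC; have [y Cy] := h _ nC;
  exact. Qed.

Lemma Sigma11_analytic (T : countType) (A : set {ptws T -> bool}) :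
  Sigma11 A -> analytic A.
Proof.
move=> [C [cC ->]]; exists (fun x v => C (x, v)); split; last first.
  by move=> x; split=> [[[x0 v] ? <-]|[v ?]]; [exists v|exists (x, v)].
move=> x v h; apply: (closed_agree cC) => U [[U1 U2] /= [/nbhs_ptws_agree[s sU]
  /nbhs_ptws_agree[t tU]] UU].
have [x' [v' [Cxv xx vv]]] := h s (\max_(i <- t) i.+1)%N.
exists (x', v') => //; apply: UU; split => /=; first exact: sU.
by apply: tU => i it; apply: vv; exact: (@bigmaxn_sup_seq _ _ i).
Qed.

Lemma Sigma11_rel_analytic (T : countType)
    (F : {ptws T -> bool} -> {ptws T -> bool} -> Prop) :
  Sigma11_rel F -> analytic_rel F.
Proof.
move=> [C [cC /seteqP[FC CF]]].
exists (fun x v => C ((x \o inl, x \o inr), v)); split; last first.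
  move=> x; split=> [Fx|[v Cv]].
    by have [[[a b] v] Cv [ea eb]] := FC (x \o inl, x \o inr) Fx; exists v;
      rewrite -ea -eb.
  by apply: (CF (x \o inl, x \o inr)); exists ((x \o inl, x \o inr), v).
move=> x v h; apply: (closed_agree cC).
move=> U [[U1 U2] /= [[[U3 U4] /= [/nbhs_ptws_agree[s3 sU3] /nbhs_ptws_agree[s4
  sU4]] UU1] /nbhs_ptws_agree[t tU]] UU].
have [x' [v' [Cxv xx vv]]] := h (map inl s3 ++ map inr s4) (\max_(i <- t) i.+1)%N.
exists ((x' \o inl, x' \o inr), v') => //; apply: UU; split => /=.
  apply: UU1; split => /=; [apply: sU3|apply: sU4] => z zs /=; apply: xx.
    by rewrite mem_cat map_f.
  by rewrite mem_cat (map_f inr zs) orbT.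
by apply: tU => i it; apply: vv; exact: (@bigmaxn_sup_seq _ _ i).
Qed.

Lemma continuous_ptws (S : countType) (phi : {ptws S -> bool} -> {ptws S -> bool}) :
  (forall z, exists s : seq S, forall x y, {in s, x =1 y} -> phi x z = phi y z) ->
  continuous phi.
Proof.
move=> h x U /nbhs_ptws_agree[s sU].
have [t tP] : exists t : seq S, forall y, {in t, y =1 x} -> {in s, phi y =1 phi x}.
  elim: s {sU} => [|i s [t tP]]; first by exists [::].
  have [u uP] := h i; exists (u ++ t) => y yx z;
    rewrite in_cons => /orP[/eqP ->|zs].
    by apply: uP => j ju; apply: yx; rewrite mem_cat ju.
  by apply: tP => // j jt; apply: yx; rewrite mem_cat jt orbT.
by apply: filterS (nbhs_ptws_eq x t) => y /tP /sU.
Qed.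

Lemma analytic_comp (T T' : countType) (h : T -> T') (A : (T -> bool) -> Prop) :
  analytic A -> analytic (fun x : T' -> bool => A (x \o h)).
Proof.
move=> [C [cC CP]]; exists (fun x v => C (x \o h) v); split; last by move=> x;
  exact: CP.
move=> x v hx; apply: cC => s n; have [x' [v' [h1 h2 h3]]] := hx (map h s) n.
by exists (x' \o h), v'; split => // z zs; apply: h2; exact: map_f.
Qed.

Lemma eq_analytic (T : countType) (A B : (T -> bool) -> Prop) :
  (forall x, A x <-> B x) -> analytic A -> analytic B.
Proof.
move=> AB [C [cC CP]]; exists C; split => // x.
by split=> [/AB/CP|/CP/AB].
Qed.

Lemma analytic_large_weight (R : archiRealFieldType) (P S : countType)
    (pos : S -> P) (w : S -> R) p : analytic (large_weight pos w p).
Proof.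
pose Q (B : S -> bool) (m k : nat) := exists2 s : seq S, unpickle k = Some s &
  [/\ uniq s, forall z, z \in s -> pos z = p /\ B z & m%:R <= \sum_(z <- s) w z].
exists (fun B v => forall m, Q B m (v m)); split.
  move=> B v h m.
  (* A first approximation serves to decode the list named by [v m]; a second one agrees with [B] on
     that list. *)
  have [B' [v' [h1 _ h3]]] := h [::] m.+1.
  have [s us _] := h1 m; rewrite h3// in us.
  have [B2 [v2 [h4 h5 h6]]] := h s m.+1.
  have [s' us'] := h4 m; rewrite h6// us in us'; move: us' => -[<-] [u1 u2 u3].
  exists s => //; split => // z zs; have [pz Bz] := u2 z zs; split => //.
  by rewrite -h5.
move=> B; split=> [lB|[v vP] m]; last by have [s _ ?] := vP m; exists s.
have /choice[f fP] : forall m, exists k, Q B m k.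
  by move=> m; have [s sP] := lB m; exists (pickle s), s => //; exact: pickleK.
by exists f.
Qed.

Lemma nat_bool_uncountable (T : Type) (X : set T) (f : (nat -> bool) -> T) :
  countable X -> (forall r, X (f r)) -> injective f -> False.
Proof.
move=> /pcard_injP[g ginj] Xf finj.
have gf : injective (g \o f).
  by move=> r r' /= /ginj h; apply: finj; apply: h; rewrite inE.
pose h n := if pselect (exists r, (g \o f) r = n) is left e then sval (cid e)
  else fun=> false.
have hK r : h ((g \o f) r) = r.
  rewrite /h; case: pselect => [e|[]]; last by exists r.
  by apply: gf; exact: (svalP (cid e)).
have := congr1 (fun d : nat -> bool => d ((g \o f) (fun n =>
  ~~ h n n))) (hK (fun n => ~~ h n n)).
by case: (h _ _).
Qed.

(** Reflexivity puts [b r'] into [E (b r')], so equal classes would relate [b r] to [b r']; thus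
    uncountably many classes would meet the [F]-class of [a]. *)
Lemma countable_index_no_perfect (X : Type) (E F : X -> X -> Prop) :
  (forall x, E x x) -> countable_index_over F E ->
  forall (a : X) (b : (nat -> bool) -> X), (forall r, F a (b r)) ->
  ~ forall r r', r <> r' -> ~ E (b r) (b r').
Proof.
move=> Exx [_ cF] a b Fab nE; apply: (@nat_bool_uncountable _ _ (fun r =>
  E (b r)) (cF a)).
  by move=> r; exists (b r) => //; exact: Fab.
move=> r r' ee; apply: contrapT => /nE; apply; rewrite ee; exact: Exx.
Qed.

(** * Embedding theorems *)

(** The generic map controls only positions with [x] false and [y] true. Exchanging [x] and [y]
    handles the others, and [large_weightU] puts each separated fibre into one of two sets of
    [J]. *)
Lemma symmetric_embedding (R : archiRealFieldType) (P S : countType) (pos : S -> P)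
    (w : S -> R) (E F : (S -> bool) -> (S -> bool) -> Prop) (J : set (set P)) :
  (forall z, 0 < w z) -> repeating pos w -> is_ideal J ->
  analytic (fun A => ~ J [set p | A p]) -> analytic_rel F ->
  (forall x y, F x y -> F y x) -> (forall x, E x x) -> countable_index_over F E ->
  (forall x y (A : P -> bool), ~ J [set p | A p] ->
     (forall p, A p -> wseparated pos w p x y) -> ~ E x y) ->
  exists phi : (S -> bool) -> S -> bool,
  [/\ (forall z, exists s : seq S, forall x y, {in s, x =1 y} ->
        phi x z = phi y z) /\
      injective phi,
    (forall x y p, wseparated pos w p (phi x) (phi y) -> wseparated pos w p x y),
    (forall x y p, (forall z, pos z = p -> x z = y z) ->
       forall z, pos z = p -> phi x z = phi y z) &
    (forall x y, F (phi x) (phi y) -> J [set p | wseparated pos w p x y])].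
Proof.
move=> w0 rep [J0 Jsub JU] anJ anF Fsym Exx cFE JE.
have [a b A Fab JA sep|phi [phi1 phi2 phi3 phi4]] :=
  generic_embedding w0 rep anF anJ.
  apply: (countable_index_no_perfect Exx cFE Fab) => r r' rr'.
  by apply: JE (JA r) _ => p; exact: sep.
exists phi; split => // x y Fxy.
pose D x y := [set p | large_weight pos w p (fun z => ~~ x z && y z)].
have JD x' y' : F (phi x') (phi y') -> J (D x' y').
  move=> F'; apply: contrapT => nJ.
  apply: (phi4 x' y' (fun p => `[< D x' y' p >])) F'; last by move=> p /asboolP.
  by under eq_set do rewrite asboolE.
apply: Jsub (JU _ _ (JD _ _ Fxy) (JD _ _ (Fsym _ _ Fxy))) => p sp.
have : large_weight pos w p (fun z => (~~ x z && y z) || (~~ y z && x z)).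
  by apply: large_weight_sub sp => z _; case: (x z); case: (y z).
by move=> /large_weightU.
Qed.

Lemma weighted_embedding (R : archiRealFieldType) (P S : countType) (pos : S -> P)
    (w : S -> R) (I : set (set S)) (J : set (set P))
    (F : {ptws S -> bool} -> {ptws S -> bool} -> Prop) :
  (forall z, 0 < w z) -> repeating pos w -> is_ideal J ->
  analytic (fun A => ~ J [set p | A p]) ->
  (forall B : S -> bool, I [set z | B z] <-> J [set p | large_weight pos w p B]) ->
  Equivalence F -> Sigma11_rel F -> countable_index_over F (E_ideal I) ->
  continuously_embeds (E_ideal I) F.
Proof.
move=> w0 rep iJ anJ IJ Feq /Sigma11_rel_analytic anF cF.
have [J0 Jsub _] := iJ.
have EJ x y : E_ideal I x y <-> J [set p | wseparated pos w p x y] by exact: IJ.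
have Exx x : E_ideal I x x.
  apply/EJ; apply: Jsub J0 => p /= /(_ 1%N)[[|z s] [_ sP]];
    first by rewrite big_nil ler10.
  by have [_] := sP z (mem_head _ _); rewrite eqxx.
have Fsym x y : F x y -> F y x by case: Feq => _ + _; apply.
have [x y A JA Ap /EJ|phi [[phi1 phi2] phi3 _ phi5]] :=
  symmetric_embedding w0 rep iJ anJ anF Fsym Exx cF.
  by move=> h; apply: JA; apply: Jsub h.
exists phi; split => //; first exact: continuous_ptws.
move=> x y; split=> [/EJ Exy|/phi5 /EJ//].
(* Images are separated on no more fibres than the points, so they stay [E_ideal I]-equivalent and
   hence [F]-related. *)
by apply: cF.1; apply/EJ; apply: Jsub Exy => p; exact: phi3.
Qed.

Lemma large_weight1 (R : archiRealFieldType) (P S : countType) (pos : S -> P) p B :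
  large_weight pos (fun=> 1 : R) p B <-> ~ finite_set [set z | pos z = p /\ B z].
Proof.
split=> [lB /finite_seqP[s sB]|nf m].
  have [t [ut tB]] := lB (size s).+1; rewrite big_const_seq count_predT
    iter_addr_0 ler_nat.
  apply/negP; rewrite -ltnNge ltnS; apply: uniq_leq_size => // z /tB.
  by have := congr1 (fun D => D z) sB => /= <-.
suff [s [us sz sB]] : exists s : seq S, [/\ uniq s, size s = m & forall z,
  z \in s -> pos z = p /\ B z].
  by exists s; split => //; rewrite big_const_seq count_predT iter_addr_0 sz.
elim: m => [|m [s [us sz sB]]]; first by exists [::].
have [z [zB zs]] : exists z, (pos z = p /\ B z) /\ z \notin s.
  apply: contrapT => h; apply: nf; apply: sub_finite_set (finite_seq s) => z zB /=.
  by apply: contrapT => /negP zs; apply: h; exists z.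
exists (z :: s); split => /=; rewrite ?zs ?sz// => z'.
by rewrite in_cons => /orP[/eqP ->|/sB].
Qed.

Lemma injective_unbounded (f : nat -> nat) : injective f ->
  forall n, exists M, forall k, (M <= k)%N -> (n <= f k)%N.
Proof.
move=> finj; elim=> [|n [M MP]]; first by exists 0%N.
have [[k0 fk0]|nk] := pselect (exists k, f k = n).
  exists (maxn M k0.+1) => k; rewrite geq_max => /andP[Mk kk].
  rewrite ltn_neqAle MP// andbT -fk0; apply/eqP => /finj h; lia.
exists M => k Mk; rewrite ltn_neqAle MP// andbT; apply/eqP => h; apply: nk;
  by exists k.
Qed.

Lemma repeating1 (R : archiRealFieldType) (P S : countType) (pos : S -> P) :
  (forall j, exists e : nat -> S, injective e /\ forall n, pos (e n) = pos j) ->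
  repeating pos (fun=> 1 : R).
Proof.
move=> h j n; have [e [einj ej]] := h j.
have [M MP] := injective_unbounded (inj_comp (pcan_inj (@pickleK_inv S)) einj) n.
exists [:: e M]; split => //; last by rewrite big_seq1; apply/andP; split; lra.
by move=> z; rewrite inE => /eqP ->; split; [exact: ej|exact: MP].
Qed.

Lemma repeating_fst (R : archiRealFieldType) (P : countType) :
  repeating (fst : P * nat -> P) (fun=> 1 : R).
Proof. by apply: repeating1 => j; exists (fun n => (j.1, n));
  split => // m n []. Qed.

Lemma repeating_unit (R : archiRealFieldType) :
  repeating (fun _ : nat => tt) (fun=> 1 : R).
Proof. by apply: repeating1 => j; exists id; split => // m n. Qed.

(** The [M] integers from [M * j.+1] on have weights between 1/(M(j+2)) and 1/(M(j+1)), in total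
    between 1/(j+2) and 1/(j+1); and 1/(j+2) is at least half of 1/(j+1). *)
Lemma repeating_harmonic (R : archiRealFieldType) :
  repeating (fun _ : nat => tt) (fun n => n.+1%:R^-1 : R).
Proof.
move=> j n; have [M0 MP] := injective_unbounded (pcan_inj (@pickleK_inv nat)) n.
pose M := M0.+1.
have h (k : nat) : (M * j.+1 <= k < M * j.+1 + M)%N ->
    (M * j.+2)%:R^-1 <= (k.+1%:R^-1 : R) <= (M * j.+1)%:R^-1.
  move=> /andP[k1 k2]; rewrite !lef_pV2 ?posrE ?ltr0n ?muln_gt0// !ler_nat.
  by apply/andP; split; rewrite ?(leq_trans k1)// mulnS; lia.
exists (index_iota (M * j.+1) (M * j.+1 + M)); split.
- exact: iota_uniq.
- move=> k; rewrite mem_index_iota => /andP[k1 _]; split => //; apply: MP.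
  by apply: leq_trans k1; rewrite /M; nia.
have cst (c : R) : \sum_(M * j.+1 <= k < M * j.+1 + M) c = c * M%:R.
  by rewrite sumr_const_nat addKn mulr_natr.
apply/andP; split.
  apply: (@le_trans _ _ ((M * j.+2)%:R^-1 * M%:R)); last first.
    by rewrite -cst; apply: ler_sum_nat => k /h/andP[].
  rewrite natrM invfM mulrAC mulVf ?pnatr_eq0// mul1r -invfM -natrM lef_pV2
    ?posrE ?ltr0n ?muln_gt0//.
  by rewrite ler_nat; lia.
apply: (@le_trans _ _ ((M * j.+1)%:R^-1 * M%:R)).
  by rewrite -cst; apply: ler_sum_nat => k /h/andP[].
by rewrite natrM invfM mulrAC mulVf ?pnatr_eq0// mul1r.
Qed.

(** Every value is taken infinitely often, namely at the codes of the pairs with that first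
    entry. *)
Definition bit_source (k : nat) : nat :=
  oapp fst 0%N (unpickle k : option (nat * nat)).

(** Here a finite difference on a fibre matters, so equivalence is preserved not by the weight bound
    but by [phi4]: equal fibres have equal images. For the converse, [rep] makes one difference
    infinite. *)
Lemma prod0_embedding (R : archiRealFieldType) (P : countType) (J : set (set P))
    (F : {ptws P * nat -> bool} -> {ptws P * nat -> bool} -> Prop) :
  is_ideal J -> analytic (fun A => ~ J [set p | A p]) ->
  Equivalence F -> Sigma11_rel F ->
  countable_index_over F (E_ideal (ideal_prod J ideal0)) ->
  continuously_embeds (E_ideal (ideal_prod J ideal0)) F.
Proof.
move=> iJ anJ Feq /Sigma11_rel_analytic anF cF.
have [J0 Jsub _] := iJ.
pose E := E_ideal (ideal_prod J ideal0).
have EJ x y : E x y <-> J [set p | exists n, x (p, n) != y (p, n)].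
  suff -> : [set p | exists n, x (p, n) != y (p, n)] =
    [set p | ~ ideal0 [set n | [set z | x z != y z] (p, n)]] by [].
  apply/seteqP; split=> p /= => [[n xy] p0|np].
    by have : set0 n by rewrite -p0.
  apply: contrapT => nn; apply: np; rewrite /ideal0 /=; apply/seteqP;
    split => // n xy.
  by apply: nn; exists n.
have Exx x : E x x by apply/EJ; apply: Jsub J0 => p [n]; rewrite eqxx.
have Fsym x y : F x y -> F y x by case: Feq => _ + _; apply.
pose w (_ : P * nat) : R := 1.
have [x y A JA Ap /EJ|phi [[phi1 phi2] _ phi4 phi5]] :=
    @symmetric_embedding R _ _ fst w E F J (fun=> ltr01) (@repeating_fst R P)
      iJ anJ anF Fsym Exx cF.
  move=> h; apply: JA; apply: Jsub h => p /= /Ap /(_ 1%N)[[|z s] [_ sP]].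
    by rewrite big_nil ler10.
  by have [zp xyz] := sP z (mem_head _ _); exists z.2;
    rewrite -zp -surjective_pairing.
pose rep (x : P * nat -> bool) (z : P * nat) := x (z.1, bit_source z.2).
have srcK (i k : nat) : bit_source (pickle (i, k)) = i
  by rewrite /bit_source pickleK.
exists (phi \o rep); split.
- apply: continuous_ptws => z; have [s sP] := phi1 z.
  exists (map (fun z => (z.1, bit_source z.2)) s) => x y xy.
  by apply: sP => z' z's; apply: xy; exact: (map_f (fun z => (z.1,
    bit_source z.2)) z's).
- move=> x y /phi2 xy; apply: funext => -[p i].
  by have := congr1 (fun f : P * nat -> bool => f (p, pickle (i, 0%N))) xy;
    rewrite /rep /= srcK.
- move=> x y; split=> [/EJ Exy|/phi5 h].
    apply: cF.1; apply/EJ; apply: Jsub Exy => p /= [n]; apply: contraPP => nn.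
    apply/negP; rewrite negbK; apply/eqP; apply: (phi4 _ _ p) => // -[q k] /= ->.
    by rewrite /rep /=; apply/eqP; apply: contrapT => /negP ?; apply: nn;
      exists (bit_source k).
  apply/EJ; apply: Jsub h => p /= [n xy]; apply/large_weight1 => fin.
  have finj : injective (fun k : nat => (p, pickle (n, k)))
    by move=> k k' [/(pcan_inj pickleK)[]].
  apply: infinite_nat; have := finite_preimage (in2W finj) fin.
  apply: sub_finite_set => k _ /=; split => //.
  by rewrite /rep /= srcK.
Qed.

(** * The listed ideals *)

Lemma FIN_weight (R : archiRealFieldType) (B : nat -> bool) :
  FIN [set n | B n] <-> ~ large_weight (fun _ : nat => tt) (fun=> 1 : R) tt B.
Proof.
have -> : FIN [set n | B n] = finite_set [set n | tt = tt /\ B n].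
  by congr finite_set; apply/seteqP; split => n //= [].
by rewrite large_weight1 notE.
Qed.

(** An [esum] of nonnegative terms is the supremum of its finite subsums, so it is finite exactly
    when these are bounded. *)
Lemma summable_weight (R : realType) (B : nat -> bool) :
  summable_ideal R [set n | B n] <->
  ~ large_weight (fun _ : nat => tt) (fun n => n.+1%:R^-1 : R) tt B.
Proof.
have B_seq (s : seq nat) : uniq s -> (\sum_(n \in [set` s]) ((n.+1%:R)^-1 : R)%:E =
    (\sum_(n <- s) (n.+1%:R)^-1 : R)%:E)%E.
  by move=> us; rewrite -fsbig_seq// sumEFin.
rewrite /summable_ideal /=; split=> [fin lB|nlB].
  have h m : ((m%:R : R)%:E <= \esum_(n in [set n | B n]) ((n.+1%:R)^-1 : R)%:E)%E.
    have [s [us sB ms]] := lB m; apply: esum_ge; exists [set` s].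
      by split; [exact: finite_seq|move=> n /sB[]].
    by rewrite B_seq// lee_fin.
  have e0 : (0 <= \esum_(n in [set n | B n]) ((n.+1%:R)^-1 : R)%:E)%E
    by exact: (h 0%N).
  move: fin h e0; case: (esum _ _) => [r|//|//] _ h r0.
  have := h (Num.bound r); rewrite lee_fin leNgt archi_boundP//.
have [m mP] : exists m : nat, forall s : seq nat, uniq s -> (forall n,
  n \in s -> B n) ->
    \sum_(n <- s) (n.+1%:R)^-1 < m%:R :> R.
  apply: contrapT => h; apply: nlB => m; apply: contrapT => h'; apply: h;
    exists m => s us sB.
  by rewrite ltNge; apply/negP => ms; apply: h'; exists s; split => // n /sB.
apply: (@le_lt_trans _ _ (m%:R : R)%:E); last exact: ltry.
apply: ge_ereal_sup => _ [X [/finite_seqP[s ->] XB] <-].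
have -> : [set` s] = [set` undup s] by apply/seteqP; split=> n /=;
  rewrite mem_undup.
rewrite B_seq ?undup_uniq// lee_fin ltW// mP ?undup_uniq// => n.
by rewrite mem_undup => /XB.
Qed.

Lemma set_asbool (T : Type) (A : set T) : A = [set x | `[< A x >]].
Proof. by apply/seteqP; split=> x /= /asboolP. Qed.

Lemma is_ideal_weight (R : archiRealFieldType) (P S : countType) (pos : S -> P)
    (w : S -> R) p (I : set (set S)) :
  (forall B : S -> bool, I [set z | B z] <-> ~ large_weight pos w p B) ->
    is_ideal I.
Proof.
move=> IP; split.
- have -> : set0 = [set z : S | xpred0 z] by apply/seteqP; split.
  apply/IP => /(_ 1%N)[[|z s] [_ sP]]; first by rewrite big_nil ler10.
  by have [] := sP z (mem_head _ _).
- move=> A B; rewrite (set_asbool A) (set_asbool B) => AB /IP nB; apply/IP;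
    apply: contra_not nB.
  by apply: large_weight_sub => z _ /AB.
- move=> A B; rewrite (set_asbool A) (set_asbool B) => /IP nA /IP nB.
  have -> : [set x | `[< A x >]] `|` [set x | `[< B x >]]
    = [set x | `[< A x >] || `[< B x >]].
    by apply/seteqP; split=> x /= => [[->|->]|/orP]; rewrite ?orbT.
  by apply/IP => /large_weightU[].
Qed.

Lemma analytic_not_weight (R : archiRealFieldType) (P S : countType) (pos : S -> P)
    (w : S -> R) p (I : set (set S)) :
  (forall B : S -> bool, I [set z | B z] <-> ~ large_weight pos w p B) ->
  analytic (fun A => ~ I [set z | A z]).
Proof.
move=> IP; apply: eq_analytic (analytic_large_weight pos w p) => B.
by rewrite IP notE.
Qed.

Lemma is_ideal_FIN : is_ideal FIN.
Proof. exact: is_ideal_weight (FIN_weight rat). Qed.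

Lemma is_ideal_summable (R : realType) : is_ideal (summable_ideal R).
Proof. exact: is_ideal_weight (@summable_weight R). Qed.

Lemma is_ideal_prod (P Q : Type) (I : set (set P)) (J : set (set Q)) :
  is_ideal I -> is_ideal J -> is_ideal (ideal_prod I J).
Proof.
move=> [I0 Isub IU] [J0 Jsub JU]; split.
- by apply: Isub I0 => x /=.
- move=> A B AB; apply: Isub => x /=; apply: contra_not; apply: Jsub => q /=;
    exact: AB.
- move=> A B IA IB; apply: Isub (IU _ _ IA IB) => x /= nAB.
  by apply/not_andP => -[JA JB]; apply: nAB; exact: JU.
Qed.

(** Composition with [fst] reduces [J] continuously to [ideal_prod J K]: the sections are empty or
    everything, and only the latter fall outside [K]. *)
Lemma Pi11_prod_analytic (P : countType) (J : set (set P)) (K : set (set nat)) :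
  K set0 -> ~ K setT -> Pi11_ideal (ideal_prod J K) ->
  analytic (fun A => ~ J [set p | A p]).
Proof.
move=> K0 KT /Sigma11_analytic/(analytic_comp (fst : P * nat -> P)).
apply: eq_analytic => A /=.
have -> // : [set p | A p] = [set p | ~ K [set q | [set z | (A \o fst) z] (p, q)]].
apply/seteqP; split=> p /= => [Ap|].
  by have -> : [set q : nat | A p] = setT by apply/seteqP; split.
apply: contra_notT => nAp.
by have -> : [set q : nat | A p] = set0 by apply/seteqP; split=> // q /=;
  rewrite (negbTE nAp).
Qed.

(** The trivial ideal on one point turns a weighted ideal on [nat] into the case of a single
    fibre. *)
Lemma is_ideal_unit : is_ideal [set set0 : set unit].
Proof.
split=> // [A B AB B0|A B -> ->]; last by rewrite setU0.
by apply/seteqP; split => //; rewrite -[X in _ `<=` X]B0.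
Qed.

Lemma analytic_unit : analytic (fun A : unit -> bool => ~ [set set0] [set p | A p]).
Proof.
apply: (@eq_analytic _ (fun A : unit -> bool => A tt)).
  move=> A; split=> [At A0|nA]; first by have : (set0 : set unit) tt by rewrite -A0.
  apply: contrapT => nAt; apply: nA; apply/seteqP; split=> [[]|] //.
exists (fun A _ => A tt); split; last by move=> A; split=> [?|[]//]; exists id.
by move=> A v h; have [A' [_ [At AA _]]] := h [:: tt] 0%N; rewrite -AA.
Qed.

Lemma weighted_nat_embedding (R : archiRealFieldType) (w : nat -> R) (I : set (set nat))
    (F : {ptws nat -> bool} -> {ptws nat -> bool} -> Prop) :
  (forall n, 0 < w n) -> repeating (fun _ : nat => tt) w ->
  (forall B : nat -> bool,
    I [set n | B n] <-> ~ large_weight (fun _ : nat => tt) w tt B) ->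
  Equivalence F -> Sigma11_rel F -> countable_index_over F (E_ideal I) ->
  continuously_embeds (E_ideal I) F.
Proof.
move=> w0 rep IP; apply: weighted_embedding w0 rep is_ideal_unit analytic_unit _.
move=> B; rewrite IP; split=> [nB|e0 lB]; first by apply/seteqP; split=> // -[].
by have : (set0 : set unit) tt by rewrite -e0.
Qed.

Lemma not_ideal0T : ~ ideal0 setT.
Proof. by move=> e; have : (set0 : set nat) 0%N by rewrite -e. Qed.

Theorem theorem4 (R : realType) (P : countType) (I : set (set P))
    (hI : listed_ideal R I)
    (F : {ptws P -> bool} -> {ptws P -> bool} -> Prop)
    (F_equiv : Equivalence F) (F_Sigma11 : Sigma11_rel F)
    (F_index : countable_index_over F (E_ideal I)) :
  continuously_embeds (E_ideal I) F.
Proof.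
case: {P I} hI F F_equiv F_Sigma11 F_index.
- move=> F; exact: (weighted_nat_embedding (fun=> ltr01) (@repeating_unit R)
    (FIN_weight R)).
- move=> F; exact: (prod0_embedding R is_ideal_FIN (analytic_not_weight
    (FIN_weight R))).
- move=> F; apply: (weighted_nat_embedding _ (@repeating_harmonic R)
    (@summable_weight R)) => n.
  by rewrite invr_gt0 ltr0n.
- move=> F; exact: (prod0_embedding R (is_ideal_summable R)
    (analytic_not_weight (@summable_weight R))).
- move=> P J iJ JFIN F.
  have aJ := Pi11_prod_analytic (finite_set0 nat) infinite_nat JFIN.
  apply: (weighted_embedding (fun=> ltr01) (@repeating_fst R P) iJ aJ) => B.
  suff -> : [set p | large_weight fst (fun=> 1 : R) p B] =
    [set p | ~ FIN [set n | [set z | B z] (p, n)]] by [].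
  apply/seteqP; split=> p /=.
    move=> /large_weight1; apply: contra_not => fin.
    apply: sub_finite_set (finite_image (pair p) fin) => -[_ n] /= [-> Bn].
    by exists n.
  move=> nfin; apply/large_weight1; apply: contra_not nfin => fin.
  apply: sub_finite_set (finite_image snd fin) => n /= Bn.
  by exists (p, n).
(* [ideal_prod J (summable_ideal R)] is itself an ideal with analytic complement, so it can take the
   place of [J] in [prod0_embedding]. *)
- move=> P J iJ /(Pi11_prod_analytic (erefl _) not_ideal0T) aJ F.
  exact: (prod0_embedding R (is_ideal_prod iJ (is_ideal_summable R)) aJ).
- move=> P J iJ /(Pi11_prod_analytic (erefl _) not_ideal0T) aJ F.
  exact: (prod0_embedding R (is_ideal_prod iJ is_ideal_FIN) aJ).
Qed.
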